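(* Let $K$ be a field, let $A$ be a noetherian semiperfect $K$-algebra and let $A'$ be a $K$-algebra. Let $F:\mathrm{Mod}\,A\to \mathrm{Mod}\,A'$ or $F:\mathrm{mod}\,A\to\mathrm{mod}\,A'$ be an equivalence functor. If $A$ is a quasi-Koszul algebra, then so is $A'$. If $M$ (an object of the domain of $F$) is a quasi-Koszul $A$-module, then $F(M)$ is a quasi-Koszul $A'$-module.
   Context: $\mathrm{Mod}\,B$ (resp. $\mathrm{mod}\,B$) denotes the category of left (resp. finitely generated left) modules over a $K$-algebra $B$, and $J(B)$ its Jacobson radical. Products of elements of extension groups are Yoneda products, written from left to right: $[\xi]\in \mathrm{Ext}^r_B(X,Y)$ and $[\zeta]\in\mathrm{Ext}^l_B(Y,Z)$ have product $[\xi][\zeta]\in\mathrm{Ext}^{r+l}_B(X,Z)$ (with $\mathrm{Ext}^0=\mathrm{Hom}$). A product of subspaces of extension groups means the $K$-span of all products of elements. $\mathrm{Ext}^*_B(X,X)=\coprod_{i\ge0}\mathrm{Ext}^i_B(X,X)$ is a graded $K$-algebra under the Yoneda product (the Yoneda algebra). A graded $K$-algebra $E=\coprod_{i\ge 0}E_i$ is generated in degree 0 and 1 if $E_i=E_1^i$ for all $i\ge 2$. A noetherian semiperfect $K$-algebra $B$ with $J=J(B)$ is quasi-Koszul if $\mathrm{Ext}^*_B(B/J,B/J)$ is generated in degree 0 and 1. A $B$-module $M$ is quasi-Koszul if $\mathrm{Ext}^i_B(M,B/J)\,\mathrm{Ext}^1_B(B/J,B/J)=\mathrm{Ext}^{i+1}_B(M,B/J)$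 for all $i\ge 0$. (Being noetherian and semiperfect is Morita invariant, so the notion makes sense for $A'$.) *)

(* Defs.v *)
From HB Require Import structures.
From mathcomp Require Import all_boot all_algebra.
From mathcomp Require Import generic_quotient ring_quotient.
From mathcomp Require Import boolp classical_sets.
From mathcomp Require Import freeg.

Set Implicit Arguments.
Unset Strict Implicit.
Unset Printing Implicit Defensive.

Import GRing.Theory.
Local Open Scope ring_scope.
Local Open Scope quotient_scope.
Local Open Scope classical_set_scope.

Section Submodules.
Variables (R : pzRingType) (V : lmodType R).

Section OfSet.
Variables (X : set V) (X0 : X 0) (XD : forall u v, X u -> X v -> X (u + v))
  (XZ : forall a v, X v -> X (a *: v)).

Definition bool_of_set (v : V) : bool := `[< X v >].

Fact bool_of_set_closed : subsemimod_closed bool_of_set.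
Proof.
split; first split; first exact/asboolP.
- by move=> u v /asboolP Xu /asboolP Xv; apply/asboolP/XD.
- by move=> a v /asboolP Xv; apply/asboolP/XZ.
Qed.

Definition submod_of_set : submodClosed V :=
  HB.pack bool_of_set
    (GRing.isSubmodClosed.Build R V bool_of_set bool_of_set_closed).

End OfSet.

Variable S : submodClosed V.

Definition submod_pred (v : V) : bool := v \in S.

Fact submod_pred_closed : subsemimod_closed submod_pred.
Proof. exact: GRing.subsemimodClosedP. Qed.

Definition submod_sort := {v : V | submod_pred v}.
HB.instance Definition _ := SubChoice.on submod_sort.
HB.instance Definition _ :=
  GRing.SubChoice_isSubLmodule.Build R V submod_pred submod_sort
    submod_pred_closed.

Definition submod_zmod : zmodClosed V :=
  HB.pack submod_pred
    (GRing.isSubmodClosed.Build R V submod_pred submod_pred_closed).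

Definition quotmod := Quotient.quot submod_zmod.
HB.instance Definition _ := EqQuotient.on quotmod.
HB.instance Definition _ := Choice.on quotmod.
HB.instance Definition _ := GRing.Zmodule.on quotmod.

Definition quot_pi (v : V) : quotmod := \pi_quotmod v.

Lemma quot_piP x : exists v, x = quot_pi v.
Proof. by exists (repr x); rewrite /quot_pi reprK. Qed.

Lemma quot_pi_eq u v : (quot_pi u == quot_pi v) = (u - v \in S).
Proof. exact: esym (Quotient.idealrBE submod_zmod u v). Qed.

Fact quot_piD : {morph quot_pi : u v / u + v}.
Proof. exact: raddfD. Qed.

Definition quot_scale (a : R) (x : quotmod) : quotmod := quot_pi (a *: repr x).

Fact quot_piZ a v : quot_scale a (quot_pi v) = quot_pi (a *: v).
Proof.
apply/eqP; rewrite quot_pi_eq -scalerBr; apply: rpredZ.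
by rewrite -quot_pi_eq; apply/eqP; exact: reprK.
Qed.

Fact quot_scaleA a b x : quot_scale a (quot_scale b x) = quot_scale (a * b) x.
Proof. by have [v ->] := quot_piP x; rewrite !quot_piZ scalerA. Qed.

Fact quot_scale1 : left_id 1 quot_scale.
Proof. by move=> x; have [v ->] := quot_piP x; rewrite quot_piZ scale1r. Qed.

Fact quot_scaleDr : right_distributive quot_scale +%R.
Proof.
move=> a x y; have [[u ->] [v ->]] := (quot_piP x, quot_piP y).
by rewrite -quot_piD !quot_piZ scalerDr quot_piD.
Qed.

Fact quot_scaleDl x : {morph quot_scale^~ x : a b / a + b}.
Proof.
by move=> a b; have [v ->] := quot_piP x; rewrite !quot_piZ scalerDl quot_piD.
Qed.

HB.instance Definition _ :=
  GRing.Zmodule_isLmodule.Build R quotmod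
    quot_scaleA quot_scale1 quot_scaleDr quot_scaleDl.

Fact quot_pi_linear : linear quot_pi.
Proof. by move=> a u v; rewrite quot_piD -quot_piZ. Qed.

HB.instance Definition _ :=
  GRing.isLinear.Build R V quotmod *:%R quot_pi quot_pi_linear.

End Submodules.

Section Modules.
Variable R : pzRingType.
Implicit Types M N P V : lmodType R.

Lemma linear_ext M N (f g : {linear M -> N}) : f =1 g -> f = g.
Proof.
case: f g => [f cf] [g cg] /= fg; have {}fg : f = g by exact: funext.
case: g / fg cg => cg; congr GRing.Linear.Pack.
case: cf cg => [[fD] [fZ]] [[gD] [gZ]].
by rewrite (Prop_irrelevance fD gD) (Prop_irrelevance fZ gZ).
Qed.

Definition surjective M N (f : M -> N) := forall y, exists x, f x = y.

Definition fin_gen M := exists (n : nat) (m : 'I_n -> M),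
  forall x, exists a : 'I_n -> R, x = \sum_i a i *: m i.

(* Ascending chain condition on submodules. *)
Definition noetherian_mod M := forall S : nat -> submodClosed M,
  (forall n, {subset S n <= S n.+1}) ->
  exists n, forall m, (n <= m)%N -> S m =i S n.

Definition projective P := forall M N (p : {linear M -> N}) (f : {linear P -> N}),
  surjective p -> exists g : {linear P -> M}, p \o g =1 f.

Definition superfluous M (S : set M) := forall T : submodClosed M,
  (forall x, exists s t, [/\ S s, t \in T & x = s + t]) -> forall x, x \in T.

Definition projective_cover M P (p : {linear P -> M}) :=
  [/\ projective P, surjective p & superfluous [set x | p x = 0]].

Definition proper_submod V (S : submodClosed V) := exists v, v \notin S.

Definition maximal_submod V (S : submodClosed V) :=
  proper_submod S /\
  forall T : submodClosed V,
    proper_submod T -> {subset S <= T} -> {subset T <= S}.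

Definition radical_set V : set V :=
  [set v | forall S : submodClosed V, maximal_submod S -> v \in S].

Fact radical0 V : radical_set (0 : V).
Proof. by move=> S _; exact: rpred0. Qed.

Fact radicalD V (u v : V) :
  radical_set u -> radical_set v -> radical_set (u + v).
Proof. by move=> uJ vJ S mS; rewrite rpredD ?uJ ?vJ. Qed.

Fact radicalZ V a (v : V) : radical_set v -> radical_set (a *: v).
Proof. by move=> vJ S mS; rewrite rpredZ ?vJ. Qed.

Definition radical V : submodClosed V :=
  submod_of_set (@radical0 V) (@radicalD V) (@radicalZ V).

End Modules.

(* Two-sided: the left modules over the converse ring are the right modules.  *)
Definition noetherian (R : pzRingType) :=
  noetherian_mod R^o /\ noetherian_mod (R^c)^o.

(* Bass's definition: every finitely generated left module has a projective
   cover. *)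
Definition semiperfect (R : pzRingType) :=
  forall M : lmodType R, fin_gen M ->
  exists (P : lmodType R) (p : {linear P -> M}), projective_cover p.

(* The Jacobson radical J(R) is the intersection of the maximal left ideals,
   i.e. of the maximal submodules of the regular module R^o. *)
Definition jacobson (R : pzRingType) : submodClosed R^o := radical R^o.

(* The left module R / J(R). *)
Definition top (R : pzRingType) : lmodType R := quotmod (jacobson R).

Section Hom.
Variables (K : fieldType) (B : algType K).
Implicit Types M N : lmodType B.

Definition Hom M N : Type := {linear M -> N}.

HB.instance Definition _ M N := gen_eqMixin (Hom M N).
HB.instance Definition _ M N := gen_choiceMixin (Hom M N).

Section Structure.
Variables M N : lmodType B.
Implicit Types f g : Hom M N.

Definition hom0 : Hom M N := \0.
Definition homN f : Hom M N := \- f.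
Definition homD f g : Hom M N := f \+ g.

Fact homDA : associative homD.
Proof. by move=> f g h; apply: linear_ext => x; exact: addrA. Qed.

Fact homDC : commutative homD.
Proof. by move=> f g; apply: linear_ext => x; exact: addrC. Qed.

Fact hom0D : left_id hom0 homD.
Proof. by move=> f; apply: linear_ext => x; exact: add0r. Qed.

Fact homND : left_inverse hom0 homN homD.
Proof. by move=> f; apply: linear_ext => x; exact: addNr. Qed.

HB.instance Definition _ :=
  GRing.isZmodule.Build (Hom M N) homDA homDC hom0D homND.

(* The image k%:A of k is central in B, so this is again B-linear. *)
Definition homZ_fun (k : K) f (x : M) : N := k%:A *: f x.

Fact homZ_linear k f : linear (homZ_fun k f).
Proof.
move=> a u v; rewrite /homZ_fun linearP scalerDr !scalerA.
by rewrite mulr_algl mulr_algr.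
Qed.

HB.instance Definition _ k f :=
  GRing.isLinear.Build B M N *:%R (homZ_fun k f) (homZ_linear k f).

Definition homZ k f : Hom M N := homZ_fun k f.

Fact homZA a b f : homZ a (homZ b f) = homZ (a * b) f.
Proof.
apply: linear_ext => x; rewrite /= /homZ_fun /= scalerA.
by rewrite -scalerAl mul1r scalerA.
Qed.

Fact hom1Z : left_id 1 homZ.
Proof. by move=> f; apply: linear_ext => x; rewrite /= /homZ_fun !scale1r. Qed.

Fact homZDr : right_distributive homZ +%R.
Proof. by move=> k f g; apply: linear_ext => x; exact: scalerDr. Qed.

Fact homZDl f : {morph homZ^~ f : a b / a + b}.
Proof.
by move=> a b; apply: linear_ext => x; rewrite /= /homZ_fun !scalerDl.
Qed.

HB.instance Definition _ :=
  GRing.Zmodule_isLmodule.Build K (Hom M N) homZA hom1Z homZDr homZDl.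

End Structure.

Record resolution (X : lmodType B) := Resolution {
  res_mod :> nat -> lmodType B;
  res_diff : forall n, {linear res_mod n.+1 -> res_mod n};
  res_aug : {linear res_mod 0 -> X};
  res_proj : forall n, projective (res_mod n);
  res_aug_surj : surjective res_aug;
  res_exact0 : forall x, res_aug x = 0 <-> exists y, x = res_diff 0 y;
  res_exactS : forall n x, res_diff n x = 0 <-> exists y, x = res_diff n.+1 y }.

Section Ext.
Variables (X : lmodType B) (P : resolution X) (Y : lmodType B).

Definition cocycle_set n : set (Hom (P n) Y) :=
  [set f | forall x, f (res_diff P n x) = 0].

Definition coboundary_set n : set (Hom (P n) Y) :=
  match n return set (Hom (P n) Y) with
  | 0 => [set f : Hom (P 0) Y | f = 0]
  | m.+1 => [set f : Hom (P m.+1) Y | exists g : Hom (P m) Y, f =1 g \o res_diff P m]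
  end.

Fact cocycle0 n : cocycle_set (0 : Hom (P n) Y).
Proof. by []. Qed.

Fact cocycleD n (f g : Hom (P n) Y) :
  cocycle_set f -> cocycle_set g -> cocycle_set (f + g).
Proof. by move=> fZ gZ x; rewrite /= fZ gZ addr0. Qed.

Fact cocycleZ n k (f : Hom (P n) Y) : cocycle_set f -> cocycle_set (k *: f).
Proof. by move=> fZ x; rewrite /= /homZ_fun fZ scaler0. Qed.

Definition cocycles n : submodClosed (Hom (P n) Y) :=
  submod_of_set (@cocycle0 n) (@cocycleD n) (@cocycleZ n).

Definition cocycle n := submod_sort (cocycles n).

Fact cocycleP n (c : cocycle n) : cocycle_set (val c).
Proof. exact/asboolP/(valP c). Qed.

Definition Cocycle n (f : Hom (P n) Y) (fZ : cocycle_set f) : cocycle n :=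
  exist _ f (asboolT fZ).

Definition cobd_cocycle n : set (cocycle n) := [set c | coboundary_set (val c)].

Fact cobd0 n : cobd_cocycle (0 : cocycle n).
Proof. by case: n => [|n] //; exists 0. Qed.

Fact cobdD n (c c' : cocycle n) :
  cobd_cocycle c -> cobd_cocycle c' -> cobd_cocycle (c + c').
Proof.
case: n c c' => [|n] c c'; rewrite /cobd_cocycle /=.
  by move=> -> ->; rewrite addr0.
by move=> [g cg] [g' cg']; exists (g + g') => x; rewrite /= cg cg'.
Qed.

Fact cobdZ n k (c : cocycle n) : cobd_cocycle c -> cobd_cocycle (k *: c).
Proof.
case: n c => [|n] c; rewrite /cobd_cocycle /=; first by move=> ->; rewrite scaler0.
by move=> [g cg]; exists (k *: g) => x; rewrite /= /homZ_fun cg.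
Qed.

Definition coboundaries n : submodClosed (cocycle n) :=
  submod_of_set (@cobd0 n) (@cobdD n) (@cobdZ n).

Definition res_ext n : lmodType K := quotmod (coboundaries n).

End Ext.

Section FreeResolution.
Implicit Types X : lmodType B.

Definition free_mod (T : choiceType) : lmodType B := {freeg T / B}.

Section Extend.
Variables (T : choiceType) (M : lmodType B) (f : T -> M).

Definition free_ext (D : free_mod T) : M := fglift f D.

Fact free_extD : {morph free_ext : u v / u + v}.
Proof.
have fB : {morph free_ext : u v / u - v} by exact: lift_is_additive.
have f0 : free_ext 0 = 0 by rewrite -[X in free_ext X](subrr 0) fB subrr.
move=> u v; have fN w : free_ext (- w) = - free_ext w.
  by rewrite -[- w]add0r fB f0 sub0r.
by rewrite -[in LHS](opprK v) fB fN opprK.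
Qed.

Lemma free_extU c t : free_ext << c *g t >> = c *: f t.
Proof. exact: liftU. Qed.

Fact free_ext_sum (s : seq T) (c : T -> B) :
  free_ext (\sum_(x <- s) << c x *g x >>) = \sum_(x <- s) c x *: f x.
Proof.
elim: s => [|x s IHs]; last by rewrite !big_cons free_extD free_extU IHs.
rewrite !big_nil; apply: (addIr (free_ext 0)).
by rewrite add0r -free_extD addr0.
Qed.

Fact free_ext_linear : linear free_ext.
Proof.
move=> a u v; rewrite free_extD; congr (_ + _).
rewrite -[LHS]/(free_ext (fgscale a u)) /fgscale.
rewrite -[X in _ = _ (free_ext X)]freeg_sumE !free_ext_sum scaler_sumr.
by apply: eq_bigr => x _; rewrite scalerA.
Qed.

HB.instance Definition _ :=
  GRing.isLinear.Build B (free_mod T) M *:%R free_ext free_ext_linear.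

End Extend.

Lemma free_projective (T : choiceType) : projective (free_mod T).
Proof.
move=> M N p f psurj.
exists (free_ext (fun t => projT1 (cid (psurj (f << t >>))))) => D /=.
rewrite -[D]freeg_sumE !linear_sum /=; apply: eq_bigr => x _.
rewrite free_extU linearZ /=; case: cid => m /= ->.
rewrite -linearZ; congr (f _); apply/eqP/freeg_eqP => y.
by rewrite coeffZ !coeffU mul1r.
Qed.

Definition free_aug X : {linear free_mod X -> X} := free_ext (@id X).

Lemma free_aug_surj X : surjective (free_aug X).
Proof. by move=> x; exists << x >>; rewrite [LHS]free_extU scale1r. Qed.

Section Kernel.
Variables (M N : lmodType B) (f : {linear M -> N}).

Fact ker0 : [set x | f x = 0] 0. Proof. exact: linear0. Qed.
Fact kerD u v :
  [set x | f x = 0] u -> [set x | f x = 0] v -> [set x | f x = 0] (u + v).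
Proof. by move=> /= fu fv; rewrite linearD fu fv addr0. Qed.
Fact kerZ a v : [set x | f x = 0] v -> [set x | f x = 0] (a *: v).
Proof. by move=> /= fv; rewrite linearZ /= fv scaler0. Qed.

Definition ker : submodClosed M := submod_of_set ker0 kerD kerZ.

End Kernel.

(* P_n is free on the underlying set of the n-th syzygy module. *)
Definition syzygy X : lmodType B := submod_sort (ker (free_aug X)).

Definition free_res_mod X (n : nat) : lmodType B := free_mod (iter n syzygy X).

Definition free_res_diff X n :
    {linear free_res_mod X n.+1 -> free_res_mod X n} :=
  (val : syzygy (iter n syzygy X) -> free_res_mod X n)
    \o free_aug (iter n.+1 syzygy X).

Fact free_res_exact X n x :
  free_aug (iter n syzygy X) x = 0 <-> exists y, x = free_res_diff X n y.
Proof.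
split=> [x0|[y ->]]; last first.
  by have /asboolP := valP (free_aug (iter n.+1 syzygy X) y).
have [y xy] := @free_aug_surj (syzygy (iter n syzygy X)) (exist _ x (asboolT x0)).
by exists y; rewrite /= xy.
Qed.

Fact free_res_exactS X n x :
  free_res_diff X n x = 0 <-> exists y, x = free_res_diff X n.+1 y.
Proof.
rewrite -free_res_exact; split=> [|x0]; last by rewrite /= x0.
by move=> x0; apply: val_inj; exact: x0.
Qed.

Definition free_resolution X : resolution X :=
  @Resolution X (free_res_mod X) (free_res_diff X) (free_aug X)
    (fun n => @free_projective _) (@free_aug_surj X)
    (@free_res_exact X 0) (@free_res_exactS X).

End FreeResolution.

Section ChainLift.
Implicit Types L : lmodType B.

Lemma projective_lift L M N (p : {linear L -> N}) (h : {linear M -> N}) :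
  projective M -> (forall x, exists y, h x = p y) ->
  exists g : {linear M -> L}, forall x, p (g x) = h x.
Proof.
move=> projM hp; pose I : set N := [set z | exists y, z = p y].
have I0 : I 0 by exists 0; rewrite linear0.
have ID u v : I u -> I v -> I (u + v).
  by move=> [y ->] [y' ->]; exists (y + y'); rewrite linearD.
have IZ a v : I v -> I (a *: v) by move=> [y ->]; exists (a *: y); rewrite linearZ.
pose S := submod_of_set I0 ID IZ.
have corestr (M' : lmodType B) (q : {linear M' -> N}) : (forall x, I (q x)) ->
    exists q' : {linear M' -> submod_sort S}, forall x, val (q' x) = q x.
  move=> qI; pose q' x : submod_sort S := exist _ (q x) (asboolT (qI x)).
  have q'L : linear q' by move=> a u v; apply: val_inj; rewrite /= linearP.
  pose q'B := GRing.isLinear.Build _ _ _ _ q' q'L.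
  by exists (HB.pack_for {linear M' -> submod_sort S} q' q'B).
have [|p' p'E] := corestr _ p; first by move=> x; exists x.
have [|h' h'E] := corestr _ h; first exact: hp.
have p'surj : surjective p'.
  move=> y; have /asboolP[x yx] := valP y.
  by exists x; apply: val_inj; rewrite p'E; exact: esym.
have [g gE] := projM _ _ _ h' p'surj.
by exists g => x; rewrite -p'E -h'E; congr val; exact: gE.
Qed.

Variables (X Y : lmodType B) (P : resolution X) (Q : resolution Y).
Variables (r : nat) (f : cocycle P Y r).

Definition chain_lift_spec (phi : forall j, {linear P (j + r)%N -> Q j}) :=
  (forall x, res_aug Q (phi 0 x) = val f x) /\
  (forall j x, res_diff Q j (phi j.+1 x) = phi j (res_diff P (j + r)%N x)).

Lemma chain_lift_exists : exists phi, chain_lift_spec phi.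
Proof.
pose ok j (g : {linear P (j + r)%N -> Q j}) :=
  forall x, exists y, g (res_diff P (j + r)%N x) = res_diff Q j y.
have dP n x : res_diff P n (res_diff P n.+1 x) = 0.
  by apply/res_exactS; exists x.
have [g0 g0E] : exists g : {linear P r -> Q 0}, forall x, res_aug Q (g x) = val f x.
  apply: projective_lift; first exact: res_proj.
  by move=> x; have [y] := res_aug_surj Q (val f x); exists y.
have g0ok : ok 0 g0.
  by move=> x; apply/res_exact0; rewrite g0E; exact: cocycleP.
have step j (g : {g | ok j g}) : {h : {h | ok j.+1 h} |
    forall x, res_diff Q j (sval h x) = sval g (res_diff P (j + r)%N x)}.
  apply: cid; case: g => g gok /=.
  have [h hE] : exists h : {linear P (j.+1 + r)%N -> Q j.+1},
      forall x, res_diff Q j (h x) = (g \o res_diff P (j + r)%N) x.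
    by apply: projective_lift; [exact: res_proj|exact: gok].
  have hok : ok j.+1 h.
    by move=> x; apply/res_exactS; rewrite hE /= dP linear0.
  by exists (exist _ h hok) => x; rewrite hE.
pose F := nat_rect (fun j => {g | ok j g}) (exist _ g0 g0ok)
  (fun j g => sval (step j g)).
exists (fun j => sval (F j)); split; first exact: g0E.
by move=> j x; exact: (svalP (step j (F j))).
Qed.

Definition chain_lift : forall j, {linear P (j + r)%N -> Q j} :=
  projT1 (cid chain_lift_exists).

Fact chain_liftP : chain_lift_spec chain_lift.
Proof. exact: projT2 (cid chain_lift_exists). Qed.

Variables (Z : lmodType B) (l : nat) (g : cocycle Q Z l).

Fact yoneda_cocycle_subproof :
  @cocycle_set _ P Z (l + r)%N (val g \o chain_lift l).
Proof.
by move=> x /=; have [_ <-] := chain_liftP; exact: cocycleP.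
Qed.

Definition yoneda_cocycle : cocycle P Z (l + r)%N :=
  Cocycle yoneda_cocycle_subproof.

End ChainLift.

(* The left-to-right product [xi][zeta]: xi is represented by a cocycle
   f : P_r -> Y, which extends to a chain map phi_j : P_(j + r) -> Q_j between
   the resolutions of X and Y; zeta is represented by g : Q_l -> Z, and the
   product is the class of g \o phi_l. The class does not depend on the choices
   of f, phi and g. *)
Definition res_yoneda (X Y Z : lmodType B) (P : resolution X)
    (Q : resolution Y) (r l : nat) (xi : res_ext P Y r) (zeta : res_ext Q Z l) :
    res_ext P Z (l + r)%N :=
  \pi_(quotmod (coboundaries P Z (l + r)%N))
    (yoneda_cocycle (repr xi) (repr zeta)).

(* Computed from the canonical free resolution. Ext 0 X Y consists of the maps
   P_0 -> Y that vanish on the image of P_1; precomposition with the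
   augmentation identifies it with Hom(X, Y). *)
Definition Ext (r : nat) (X Y : lmodType B) : lmodType K :=
  res_ext (free_resolution X) Y r.

Definition yoneda (r l : nat) (X Y Z : lmodType B)
    (xi : Ext r X Y) (zeta : Ext l Y Z) : Ext (l + r)%N X Z :=
  res_yoneda xi zeta.

Definition lin_span (V : lmodType K) (S : set V) : set V :=
  [set v | exists (n : nat) (a : 'I_n -> K) (x : 'I_n -> V),
     (forall i, S (x i)) /\ v = \sum_i a i *: x i].

Definition ext_prod (r l : nat) (X Y Z : lmodType B)
    (S : set (Ext r X Y)) (T : set (Ext l Y Z)) : set (Ext (l + r)%N X Z) :=
  lin_span [set z | exists xi zeta, [/\ S xi, T zeta & z = yoneda xi zeta]].

(* ext1_pow X n is the power E_1^(n + 1) inside E_(n + 1) = Ext^(n + 1)(X, X). *)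
Fixpoint ext1_pow (X : lmodType B) (n : nat) : set (Ext n.+1 X X) :=
  match n with
  | 0 => setT
  | m.+1 => @ext_prod m.+1 1 X X X (@ext1_pow X m) setT
  end.

(* E_i = E_1^i for all i >= 2, where E is the Yoneda algebra of X. *)
Definition yoneda_generated01 (X : lmodType B) :=
  forall n, @ext1_pow X n.+1 = setT.

End Hom.

Definition quasi_koszul (K : fieldType) (B : algType K) :=
  [/\ noetherian B, semiperfect B & yoneda_generated01 (top B)].

Definition quasi_koszul_mod (K : fieldType) (B : algType K) (M : lmodType B) :=
  [/\ noetherian B, semiperfect B &
      forall i, @ext_prod _ _ i 1 M (top B) (top B) setT setT = setT].

Record category := Category {
  obj :> Type;
  hom : obj -> obj -> Type;
  idm : forall X, hom X X;
  comp : forall X Y Z, hom Y Z -> hom X Y -> hom X Z;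
  compA : forall X Y Z W (h : hom Z W) (g : hom Y Z) (f : hom X Y),
    comp h (comp g f) = comp (comp h g) f;
  comp1m : forall X Y (f : hom X Y), comp (idm Y) f = f;
  compm1 : forall X Y (f : hom X Y), comp f (idm X) = f }.

Record functor (C D : category) := Functor {
  fobj :> C -> D;
  fhom : forall X Y, hom X Y -> hom (fobj X) (fobj Y);
  fhom1 : forall X, fhom (idm X) = idm (fobj X);
  fhomM : forall X Y Z (g : hom Y Z) (f : hom X Y),
    fhom (comp g f) = comp (fhom g) (fhom f) }.

Definition idF (C : category) : functor C C :=
  @Functor C C id (fun _ _ f => f) (fun _ => erefl) (fun _ _ _ _ _ => erefl).

Section CompF.
Variables (C D E : category) (G : functor D E) (F : functor C D).

Fact compF1 X : fhom G (fhom F (idm X)) = idm (G (F X)).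
Proof. by rewrite !fhom1. Qed.

Fact compFM X Y Z (g : hom Y Z) (f : hom X Y) :
  fhom G (fhom F (comp g f)) = comp (fhom G (fhom F g)) (fhom G (fhom F f)).
Proof. by rewrite !fhomM. Qed.

Definition compF : functor C E :=
  @Functor C E (fun X => G (F X)) (fun _ _ f => fhom G (fhom F f))
    compF1 compFM.

End CompF.

Definition is_iso (C : category) (X Y : C) (f : hom X Y) :=
  exists g : hom Y X, comp g f = idm X /\ comp f g = idm Y.

Definition nat_iso (C D : category) (F G : functor C D) :=
  exists eta : forall X : C, hom (F X) (G X),
    (forall X, is_iso (eta X)) /\
    (forall (X Y : C) (f : hom X Y),
       comp (eta Y) (fhom F f) = comp (fhom G f) (eta X)).

Definition is_equivalence (C D : category) (F : functor C D) :=
  exists G : functor D C,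
    nat_iso (compF G F) (idF C) /\ nat_iso (compF F G) (idF D).

Section ModuleCategory.
Variable R : pzRingType.
Implicit Types L M N P : lmodType R.

Definition lin_id M : {linear M -> M} := idfun.
Definition lin_comp L M N (g : {linear M -> N}) (f : {linear L -> M}) :
  {linear L -> N} := g \o f.

Fact lin_compA L M N P (h : {linear N -> P}) (g : {linear M -> N})
    (f : {linear L -> M}) :
  lin_comp h (lin_comp g f) = lin_comp (lin_comp h g) f.
Proof. exact: linear_ext. Qed.

Fact lin_comp1m M N (f : {linear M -> N}) : lin_comp (lin_id N) f = f.
Proof. exact: linear_ext. Qed.

Fact lin_compm1 M N (f : {linear M -> N}) : lin_comp f (lin_id M) = f.
Proof. exact: linear_ext. Qed.

(* All left R-modules. *)
Definition Mod : category :=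
  @Category (lmodType R) (fun M N => {linear M -> N}) lin_id lin_comp
    lin_compA lin_comp1m lin_compm1.

End ModuleCategory.

Definition full_subcategory (C : category) (P : C -> Prop) : category :=
  @Category {X : C | P X} (fun X Y => hom (sval X) (sval Y))
    (fun X => idm (sval X)) (fun X Y Z g f => comp g f)
    (fun X Y Z W => @compA C _ _ _ _) (fun X Y => @comp1m C _ _)
    (fun X Y => @compm1 C _ _).

(* Finitely generated left R-modules. *)
Definition fgMod (R : pzRingType) : category :=
  full_subcategory (fun M : Mod R => fin_gen M).

(* Main.v *)
Require Import Defs.
From HB Require Import structures.
From mathcomp Require Import all_boot all_algebra.
From mathcomp Require Import boolp classical_sets.
(* so that Hom is the module of linear maps, not its finite-dimensional namesake *)
Import Defs.

(** The functor F is not assumed to be K-linear, and Ext is computed from free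
    resolutions that F does not preserve, so the proof rests on a criterion for

      Ext^i(X, T) Ext^1(T, T) = Ext^(i+1)(X, T)          with T = B/J(B)

    that only speaks of exact sequences. Let W be the i-th syzygy of X in some
    projective resolution, so that Ext^(i+1)(X, T) = Ext^1(W, T). Maps W -> T
    represent the classes in Ext^i(X, T), and the product of the class of
    s : W -> T with b in Ext^1(T, T) is the pullback of b along s. Such a
    pullback vanishes on the kernel of s. Conversely, a class in Ext^1(W, T)
    that vanishes on the common kernel V of s_1, ..., s_n : W -> T comes from
    Ext^1(W/V, T), and W/V, as a submodule of the semisimple module T^n, is a
    direct summand of it, so that the class is a sum of pullbacks along the s_k.
    Hence the equality above says that each class in Ext^1(W, T) vanishes on the
    common kernel of finitely many maps W -> T. This is the predicate ext1_dies,
    stated for a presentation of W; ext_prod_ext1_dies and ext1_dies_ext_prod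
    relate it to the Yoneda product. A scalar in a K-linear combination of
    products is absorbed by one of its factors.

    The criterion has the invariance that is needed. It passes from W to W'
    whenever W' is a direct summand of the sum of a finite power of W and a
    projective module (ext1_dies_stable_retract), which by a form of Schanuel's
    lemma (stable_retract_syzygy) makes it independent of the resolution and
    reduces the syzygies of a summand of X^n to those of X. In both occurrences
    T may be replaced by a module with the same finite powers up to summands
    (retract_ext1_dies_coef, retract_ext1_dies_test).

    An equivalence F between categories of modules preserves and reflects
    surjections, injections, kernels, projectives, sums of maps, the ascending
    chain condition, and the vanishing of the radical. So F carries the
    criterion over (fmap_ext1_dies), and F(A/J(A)) and A'/J(A') are summands of
    finite powers of one another: over a semiperfect ring these summands of
    powers of B/J(B) are the finitely generated modules with zero radical
    (radical_free_retract). This handles M and the algebra itself alike, as the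
    algebra is quasi-Koszul when the equality holds for X = T and all i >= 1.

    It remains to see that A' is noetherian and semiperfect. It is left
    noetherian as a quotient of a finite power of F(A) (left_noetherian_fmap);
    it is right noetherian because A' = End(P)^op for a finitely generated
    projective A-module P, and left ideals of End(P) are governed by right
    A-submodules of Hom(P, A) (right_noetherian_fmap). Projective covers are
    preserved (semiperfect_transport). *)

Set Implicit Arguments.
Unset Strict Implicit.
Unset Printing Implicit Defensive.

Import GRing.Theory.
Local Open Scope ring_scope.
Local Open Scope classical_set_scope.

(** * Linear maps, submodules and quotients *)

Section LinearMaps.
Variable R : pzRingType.
Implicit Types (L M N P Q : lmodType R).

Definition mk_linear M N (f : M -> N) (fL : linear f) : {linear M -> N} :=
  HB.pack_for {linear M -> N} f (GRing.isLinear.Build R M N *:%R f fL).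

Lemma mk_linearE M N (f : M -> N) (fL : linear f) x : mk_linear fL x = f x.
Proof. by []. Qed.

(** Partially defined linear maps are carried by total functions: this avoids
    the types of elements of a submodule, and extending such a map to a larger
    submodule is agreement of functions. *)
Definition linear_on M N (S : set M) (f : M -> N) :=
  forall a u v, S u -> S v -> f (a *: u + v) = a *: f u + f v.

Lemma linear_onD M N (S : set M) (f : M -> N) u v :
  linear_on S f -> S u -> S v -> f (u + v) = f u + f v.
Proof. by move=> fL Su Sv; have := fL 1 u v Su Sv; rewrite !scale1r. Qed.

Lemma linear_on0 M N (S : set M) (f : M -> N) : linear_on S f -> S 0 -> f 0 = 0.
Proof.
by move=> fL S0; apply: (addIr (f 0)); rewrite add0r -(linear_onD fL) ?addr0.
Qed.

Lemma linear_on_ker_sum M N Q (e : {linear M -> Q}) (f : M -> N)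
    (I : finType) (x : I -> M) :
  linear_on [set x | e x = 0] f -> (forall i, e (x i) = 0) ->
  f (\sum_i x i) = \sum_i f (x i).
Proof.
move=> fL x0.
have f0 : f 0 = 0 by apply: (linear_on0 fL); exact: linear0.
suff [] : e (\sum_i x i) = 0 /\ f (\sum_i x i) = \sum_i f (x i) by [].
apply: (big_ind2 (fun u v => e u = 0 /\ f u = v)) => //; first by rewrite linear0.
by move=> u _ v _ [u0 <-] [v0 <-]; rewrite (linear_onD fL) // linearD u0 v0 addr0.
Qed.

(** The induced map is linear on the range of p and arbitrary elsewhere. *)
Lemma descend L M N (p : {linear L -> M}) (h : {linear L -> N}) :
  (forall x, p x = 0 -> h x = 0) -> exists g : M -> N, forall x, g (p x) = h x.
Proof.
move=> ph.
have hz y : exists z, forall x, p x = y -> h x = z.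
  have [[x <-]|noy] := pselect (exists x, p x = y); last first.
    by exists 0 => x xy; case: noy; exists x.
  exists (h x) => x' xx'; apply/eqP; rewrite -subr_eq0 -linearB; apply/eqP/ph.
  by rewrite linearB xx' subrr.
by have [g gE] := choice hz; exists g => x; apply/esym; apply: gE.
Qed.

Lemma descend_linear_on L M N (p : {linear L -> M}) (h : {linear L -> N})
    (g : M -> N) :
  (forall x, g (p x) = h x) -> linear_on [set y | exists x, y = p x] g.
Proof. by move=> gE a _ _ [x ->] [y ->]; rewrite -linearP !gE linearP. Qed.

Lemma factor_surj L M N (p : {linear L -> M}) (h : {linear L -> N}) :
  surjective p -> (forall x, p x = 0 -> h x = 0) ->
  exists g : {linear M -> N}, forall x, g (p x) = h x.
Proof.
move=> psurj /descend[g gE]; have gL : linear g.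
  move=> a u v; have [[x <-] [y <-]] := (psurj u, psurj v).
  by apply: (descend_linear_on gE); [exists x|exists y].
by exists (mk_linear gL).
Qed.

Lemma corestrict L M N (i : {linear L -> N}) (h : {linear M -> N}) :
  injective i -> (forall x, exists y, h x = i y) ->
  exists g : {linear M -> L}, forall x, i (g x) = h x.
Proof.
move=> iinj /choice[g gE]; have gL : linear g.
  by move=> a u v; apply: iinj; rewrite linearP -!gE linearP.
by exists (mk_linear gL) => x; rewrite mk_linearE -gE.
Qed.

Lemma linear_injective M N (f : {linear M -> N}) :
  (forall x, f x = 0 -> x = 0) -> injective f.
Proof.
move=> f0 x y fxy; apply/eqP; rewrite -subr_eq0; apply/eqP/f0.
by rewrite linearB fxy subrr.
Qed.

Lemma injective_eq0 M N (f : {linear M -> N}) x :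
  injective f -> f x = 0 -> x = 0.
Proof. by move=> finj fx0; apply: finj; rewrite fx0 linear0. Qed.

Definition smulr_map M (x : M) : {linear R^o -> M}.
Proof.
apply: (@mk_linear R^o M (fun a : R => a *: x)).
by move=> a b c; rewrite scalerDl scalerA.
Defined.

Lemma linear_from_regular M (f : {linear R^o -> M}) (a : R) : f a = a *: f 1.
Proof.
have e : (a : R^o) = a *: (1 : R^o) by exact: esym (mulr1 a).
by rewrite {1}e linearZ.
Qed.

Section SumMap.
Variables (I : finType) (M N P : lmodType R).

Fact sum_map_linear (a : I -> {linear M -> N}) :
  linear (fun x => \sum_i a i x).
Proof.
move=> k u v; rewrite scaler_sumr -big_split /=.
by apply: eq_bigr => i _; rewrite linearP.
Qed.

Definition sum_map (a : I -> {linear M -> N}) : {linear M -> N} :=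
  mk_linear (sum_map_linear a).

Lemma sum_mapE a x : sum_map a x = \sum_i a i x.
Proof. by []. Qed.

Fact tuple_map_linear (a : I -> {linear M -> N}) :
  linear (fun x => [ffun i => a i x] : {ffun I -> N}).
Proof. by move=> k u v; apply/ffunP => i; rewrite !ffunE linearP. Qed.

Definition tuple_map (a : I -> {linear M -> N}) : {linear M -> {ffun I -> N}} :=
  mk_linear (tuple_map_linear a).

Lemma tuple_mapE a x i : tuple_map a x i = a i x.
Proof. exact: ffunE. Qed.

Fact proj_map_linear (i : I) : linear (fun v : {ffun I -> M} => v i).
Proof. by move=> k u v; rewrite !ffunE. Qed.

Definition proj_map (i : I) : {linear {ffun I -> M} -> M} :=
  mk_linear (proj_map_linear i).

Fact inj_map_linear (i : I) :
  linear (fun x : M => [ffun j => if j == i then x else 0] : {ffun I -> M}).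
Proof.
move=> k u v; apply/ffunP => j; rewrite !ffunE.
by case: eqP => // _; rewrite scaler0 addr0.
Qed.

Definition inj_map (i : I) : {linear M -> {ffun I -> M}} :=
  mk_linear (inj_map_linear i).

Lemma ffun_sum_inj (v : {ffun I -> M}) : v = \sum_i inj_map i (v i).
Proof.
apply/ffunP => j; rewrite sum_ffunE (bigD1 j) //= ffunE eqxx big1 ?addr0 //.
by move=> i /negPf ij; rewrite ffunE eq_sym ij.
Qed.

End SumMap.

Lemma submodN M (S : submodClosed M) x : x \in S -> - x \in S.
Proof. by move=> xS; rewrite -scaleN1r rpredZ. Qed.

Lemma submodB M (S : submodClosed M) x y : x \in S -> y \in S -> x - y \in S.
Proof. by move=> xS yS; rewrite rpredD ?submodN. Qed.

Section Preimage.
Variables (M N : lmodType R) (f : {linear M -> N}).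

Section Of.
Variable S : submodClosed N.
Fact pre0 : [set x | f x \in S] 0. Proof. by rewrite /= linear0 rpred0. Qed.
Fact preD u v :
  [set x | f x \in S] u -> [set x | f x \in S] v -> [set x | f x \in S] (u + v).
Proof. by rewrite /= linearD => ? ?; rewrite rpredD. Qed.
Fact preZ a v : [set x | f x \in S] v -> [set x | f x \in S] (a *: v).
Proof. by rewrite /= linearZ => ?; rewrite rpredZ. Qed.
Definition preim_submod : submodClosed M := submod_of_set pre0 preD preZ.
Lemma in_preim x : (x \in preim_submod) = (f x \in S).
Proof. by apply/asboolP/idP. Qed.
End Of.

Section Img.
Variable S : submodClosed M.
Fact img0 : [set y | exists2 x, x \in S & y = f x] 0.
Proof. by exists 0; rewrite ?rpred0 ?linear0. Qed.
Fact imgD u v :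
  [set y | exists2 x, x \in S & y = f x] u ->
  [set y | exists2 x, x \in S & y = f x] v ->
  [set y | exists2 x, x \in S & y = f x] (u + v).
Proof. by move=> [x Sx ->] [y Sy ->]; exists (x + y); rewrite ?rpredD ?linearD. Qed.
Fact imgZ a v :
  [set y | exists2 x, x \in S & y = f x] v ->
  [set y | exists2 x, x \in S & y = f x] (a *: v).
Proof. by move=> [x Sx ->]; exists (a *: x); rewrite ?rpredZ ?linearZ. Qed.
Definition image_submod : submodClosed N := submod_of_set img0 imgD imgZ.
Lemma image_submodP y : reflect (exists2 x, x \in S & y = f x) (y \in image_submod).
Proof. exact: asboolP. Qed.
End Img.

Fact kerset0 : [set x | f x = 0] 0. Proof. exact: linear0. Qed.
Fact kersetD u v :
  [set x | f x = 0] u -> [set x | f x = 0] v -> [set x | f x = 0] (u + v).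
Proof. by move=> /= fu fv; rewrite linearD fu fv addr0. Qed.
Fact kersetZ a v : [set x | f x = 0] v -> [set x | f x = 0] (a *: v).
Proof. by move=> /= fv; rewrite linearZ /= fv scaler0. Qed.
Definition kernel : submodClosed M := submod_of_set kerset0 kersetD kersetZ.
Lemma kernelP x : reflect (f x = 0) (x \in kernel).
Proof. exact: asboolP. Qed.

End Preimage.

Definition range_submod M N (f : {linear M -> N}) : submodClosed N :=
  image_submod f (kernel (\0 : {linear M -> N})).

Lemma range_submodP M N (f : {linear M -> N}) y :
  y \in range_submod f <-> exists x, y = f x.
Proof.
split=> [/image_submodP[x _ ->]|[x ->]]; first by exists x.
by apply/image_submodP; exists x => //; apply/kernelP.
Qed.

Definition submod_incl M (S : submodClosed M) : {linear submod_sort S -> M} := val.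

Lemma submod_incl_inj M (S : submodClosed M) : injective (submod_incl S).
Proof. exact: val_inj. Qed.

Lemma submod_inclP M (S : submodClosed M) x : submod_incl S x \in S.
Proof. exact: (valP x). Qed.

Lemma submod_inclE M (S : submodClosed M) x :
  x \in S <-> exists y, x = submod_incl S y.
Proof.
split=> [Sx|[y ->]]; last exact: submod_inclP.
by exists (exist _ x Sx : submod_sort S).
Qed.

Definition quotient_map M (S : submodClosed M) : {linear M -> quotmod S} :=
  @quot_pi R M S.

Lemma quotient_map_eq0 M (S : submodClosed M) x :
  quotient_map S x = 0 <-> x \in S.
Proof.
rewrite -(linear0 (quotient_map S)).
split=> [/eqP|xS]; last apply/eqP; by rewrite quot_pi_eq subr0.
Qed.

Lemma quotient_map_eq M (S : submodClosed M) x y :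
  quotient_map S x = quotient_map S y <-> x - y \in S.
Proof.
rewrite -quotient_map_eq0 linearB; split=> [->|/eqP]; first exact: subrr.
by rewrite subr_eq0 => /eqP.
Qed.

Lemma quotient_map_surj M (S : submodClosed M) : surjective (quotient_map S).
Proof. by move=> y; have [x ->] := quot_piP y; exists x. Qed.

Lemma cokernel0_surjective M N (f : {linear M -> N}) :
  (forall y, quotient_map (range_submod f) y = 0) -> surjective f.
Proof.
by move=> f0 y; have /quotient_map_eq0/range_submodP[x ->] := f0 y; exists x.
Qed.

End LinearMaps.

(** * Noetherian and finitely generated modules *)

Section Noetherian.
Variable R : pzRingType.
Implicit Types (L M N P Q : lmodType R).

Lemma chain_le M (S : nat -> submodClosed M) :
  (forall n, {subset S n <= S n.+1}) ->
  forall m n, (m <= n)%N -> {subset S m <= S n}.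
Proof.
move=> Sinc m n /subnK <-; elim: (n - m)%N => // k IHk x /IHk.
exact: Sinc.
Qed.

Lemma noetherian_surj M N (f : {linear M -> N}) :
  surjective f -> noetherian_mod M -> noetherian_mod N.
Proof.
move=> fsurj Mnoeth S Sinc.
have [n0 n0P] : exists n, forall m, (n <= m)%N ->
    preim_submod f (S m) =i preim_submod f (S n).
  by apply: Mnoeth => n x; rewrite !in_preim; exact: Sinc.
exists n0 => m /n0P eqS y; have [x <-] := fsurj y.
by have := eqS x; rewrite !in_preim.
Qed.

Lemma noetherian_ext M N Q (j : {linear N -> M}) (p : {linear M -> Q}) :
  (forall x, p x = 0 -> exists y, x = j y) ->
  noetherian_mod N -> noetherian_mod Q -> noetherian_mod M.
Proof.
move=> exact_jp Nnoeth Qnoeth S Sinc.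
have [n1 n1P] : exists n, forall m, (n <= m)%N ->
    preim_submod j (S m) =i preim_submod j (S n).
  by apply: Nnoeth => n x; rewrite !in_preim; exact: Sinc.
have [n2 n2P] : exists n, forall m, (n <= m)%N ->
    image_submod p (S m) =i image_submod p (S n).
  apply: Qnoeth => n y /image_submodP[x xS ->].
  by apply/image_submodP; exists x => //; exact: Sinc.
exists (maxn n1 n2) => m; rewrite geq_max => /andP[n1m n2m] x.
have S1 := chain_le Sinc (leq_maxl n1 n2).
have S2 := chain_le Sinc (leq_maxr n1 n2).
have Sm : {subset S (maxn n1 n2) <= S m}.
  by apply: (chain_le Sinc); rewrite geq_max n1m.
apply/idP/idP => [xm|]; last exact: Sm.
have /image_submodP[x' x'S pxx'] : p x \in image_submod p (S n2).
  by rewrite -(n2P _ n2m); apply/image_submodP; exists x.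
have [|y xy] := exact_jp (x - x'); first by rewrite linearB pxx' subrr.
have : y \in preim_submod j (S n1).
  by rewrite -(n1P _ n1m) in_preim -xy submodB // Sm // S2.
by rewrite in_preim -xy => /S1 /rpredD /(_ (S2 _ x'S)); rewrite subrK.
Qed.

Lemma noetherian_inj M N (f : {linear N -> M}) :
  injective f -> noetherian_mod M -> noetherian_mod N.
Proof.
move=> finj Mnoeth S Sinc.
have [n0 n0P] : exists n, forall m, (n <= m)%N ->
    image_submod f (S m) =i image_submod f (S n).
  apply: Mnoeth => n y /image_submodP[x xS ->].
  by apply/image_submodP; exists x => //; exact: Sinc.
have memS n x : (f x \in image_submod f (S n)) = (x \in S n).
  by apply/image_submodP/idP => [[x' ? /finj ->]//|]; exists x.
by exists n0 => m /n0P eqS x; rewrite -!memS eqS.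
Qed.

Lemma noetherian_ffun (I : finType) M :
  noetherian_mod M -> noetherian_mod {ffun I -> M}.
Proof.
move=> Mnoeth; suff ordP n : noetherian_mod {ffun 'I_n -> M}.
  pose f := tuple_map (fun i : I => proj_map M (enum_rank i)).
  apply: (noetherian_surj (f := f)) (ordP #|I|) => v.
  exists [ffun k => v (enum_val k)]; apply/ffunP => i.
  by rewrite tuple_mapE /= ffunE enum_rankK.
elim: n => [|n IHn].
  move=> S _; exists 0 => m _ x; have -> : x = 0 by apply/ffunP => - [].
  by rewrite !rpred0.
pose ext (v : {ffun 'I_n -> M}) : {ffun 'I_n.+1 -> M} :=
  [ffun i => if unlift ord0 i is Some j then v j else 0].
have extL : linear ext.
  move=> a u v; apply/ffunP => i; rewrite !ffunE.
  by case: unliftP => [j _|_]; rewrite ?ffunE // scaler0 addr0.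
apply: (@noetherian_ext _ _ _ (mk_linear extL) (proj_map M ord0)) => // v v0.
exists [ffun j => v (lift ord0 j)]; apply/ffunP => i; rewrite !ffunE.
by case: unliftP => [j ->|->]; rewrite ?ffunE //.
Qed.

Lemma fin_gen_surj M N (f : {linear M -> N}) :
  surjective f -> fin_gen M -> fin_gen N.
Proof.
move=> fsurj [n [m mP]]; exists n, (f \o m) => y.
have [x <-] := fsurj y; have [a ->] := mP x; exists a.
by rewrite linear_sum; apply: eq_bigr => i _; rewrite linearZ.
Qed.

Definition lin_comb (I : finType) M (m : I -> M) : {linear {ffun I -> R^o} -> M} :=
  sum_map (fun i => smulr_map (m i) \o proj_map (R^o) i).

Lemma lin_combE (I : finType) M (m : I -> M) (v : {ffun I -> R^o}) :
  lin_comb m v = \sum_i (v i : R) *: m i.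
Proof. by []. Qed.

Lemma fin_genP M :
  fin_gen M <->
  exists n (p : {linear {ffun 'I_n -> R^o} -> M}), surjective p.
Proof.
split=> [[n [m mP]]|[n [p psurj]]].
  exists n, (lin_comb m) => x; have [a ->] := mP x; exists [ffun i => a i].
  by rewrite lin_combE; apply: eq_bigr => i _; rewrite ffunE.
exists n, (fun i => p (inj_map (R^o) i 1)) => x; have [v <-] := psurj x.
exists v; rewrite {1}[v]ffun_sum_inj linear_sum; apply: eq_bigr => i _.
rewrite -linearZ; congr (p _); apply/ffunP => j; rewrite !ffunE.
by case: eqP => _; [exact: esym (mulr1 _)|rewrite scaler0].
Qed.

Lemma fin_gen_regular : fin_gen (R^o).
Proof.
exists 1, (fun=> 1) => x; exists (fun=> x); rewrite big_ord1.
exact: esym (mulr1 x).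
Qed.

Lemma fin_gen_noetherian M :
  noetherian_mod (R^o) -> fin_gen M -> noetherian_mod M.
Proof.
move=> Rnoeth /fin_genP[n [p psurj]].
exact: (noetherian_surj psurj (noetherian_ffun Rnoeth)).
Qed.

Section Span.
Variables (M : lmodType R) (n : nat) (m : 'I_n -> M).
Definition span : submodClosed M := range_submod (lin_comb m).
Lemma spanP x : x \in span <-> exists a : 'I_n -> R, x = \sum_i a i *: m i.
Proof.
split=> [/range_submodP[v ->]|[a ->]]; first by exists v.
apply/range_submodP; exists [ffun i => a i].
by rewrite lin_combE; apply: eq_bigr => i _; rewrite ffunE.
Qed.
Lemma mem_span i : m i \in span.
Proof.
apply/spanP; exists (fun j => (j == i)%:R); rewrite (bigD1 i) //= eqxx scale1r.
by rewrite big1 ?addr0 // => j /negPf ->; rewrite scale0r.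
Qed.
End Span.

(** Otherwise the spans of longer and longer families, each chosen outside the
    span of the preceding ones, form a strictly increasing chain. *)
Lemma noetherian_fin_gen M : noetherian_mod M -> fin_gen M.
Proof.
move=> Mnoeth; apply: contrapT => Mnfg.
have /choice[next nextP] : forall s : seq M,
    exists x, x \notin span (fun i : 'I_(size s) => s`_i).
  move=> s; apply: contrapT => no; apply: Mnfg.
  exists (size s), (fun i => s`_i) => x; apply/spanP.
  by apply: contrapT => xs; apply: no; exists x; apply/negP.
pose s n := iter n (fun t => rcons t (next t)) [::].
have sS n : s n.+1 = rcons (s n) (next (s n)) by [].
have ss n : size (s n) = n by elim: n => //= n IHn; rewrite size_rcons IHn.
have sub n : {subset span (fun i : 'I_(size (s n)) => (s n)`_i) <=
                     span (fun i : 'I_(size (s n.+1)) => (s n.+1)`_i)}.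
  move=> _ /spanP[a ->]; apply: rpred_sum => i _; apply: rpredZ.
  have lt_i : (i < size (s n.+1))%N by rewrite sS size_rcons ltnS ltnW.
  have -> : (s n)`_i = (s n.+1)`_(Ordinal lt_i).
    by rewrite -[RHS]/((rcons (s n) (next (s n)))`_i) nth_rcons ltn_ord.
  exact: mem_span.
have [n nP] := Mnoeth _ sub.
have lt_n : (n < size (s n.+1))%N by rewrite ss.
have := nextP (s n); rewrite -(nP _ (leqnSn n)) => /negP; apply.
have -> : next (s n) = (s n.+1)`_(Ordinal lt_n).
  by rewrite -[RHS]/((rcons (s n) (next (s n)))`_n) nth_rcons ss ltnn eqxx.
exact: mem_span.
Qed.

Lemma fin_gen_inj M N (f : {linear N -> M}) :
  noetherian_mod (R^o) -> injective f -> fin_gen M -> fin_gen N.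
Proof.
move=> Rnoeth finj /(fin_gen_noetherian Rnoeth) Mnoeth.
exact/noetherian_fin_gen/(noetherian_inj finj).
Qed.

Lemma fin_gen_prod M N :
  noetherian_mod (R^o) -> fin_gen M -> fin_gen N -> fin_gen (M * N)%type.
Proof.
move=> Rnoeth /(fin_gen_noetherian Rnoeth) Mnoeth.
move=> /(fin_gen_noetherian Rnoeth) Nnoeth; apply: noetherian_fin_gen.
have inlL : linear (fun x : M => (x, 0 : N)).
  by move=> a u v; apply: injective_projections; rewrite //= scaler0 addr0.
apply: (@noetherian_ext _ _ _ (mk_linear inlL) snd) => // - [x y] /= ->.
by exists x.
Qed.

End Noetherian.

(** * Radicals, projective covers and retracts *)

Section Radical.
Variable R : pzRingType.
Implicit Types (L M N P Q : lmodType R).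

Section SumSubmod.
Variables (M : lmodType R) (S T : submodClosed M).
Let sum_set : set M := [set x | exists s t, [/\ s \in S, t \in T & x = s + t]].
Fact sum0 : sum_set 0.
Proof. by exists 0, 0; rewrite !rpred0 addr0. Qed.
Fact sumD u v : sum_set u -> sum_set v -> sum_set (u + v).
Proof.
move=> [s [t [sS tT ->]]] [s' [t' [s'S t'T ->]]]; exists (s + s'), (t + t').
by rewrite !rpredD // addrACA.
Qed.
Fact sumZ a v : sum_set v -> sum_set (a *: v).
Proof.
by move=> [s [t [sS tT ->]]]; exists (a *: s), (a *: t); rewrite !rpredZ ?scalerDr.
Qed.
Definition sum_submod : submodClosed M := submod_of_set sum0 sumD sumZ.
Lemma sum_submodP x :
  x \in sum_submod <-> exists s t, [/\ s \in S, t \in T & x = s + t].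
Proof. by split=> [/asboolP|?]; last apply/asboolP. Qed.
Lemma sum_submodl : {subset S <= sum_submod}.
Proof. by move=> x xS; apply/sum_submodP; exists x, 0; rewrite rpred0 addr0. Qed.
Lemma sum_submodr : {subset T <= sum_submod}.
Proof. by move=> x xT; apply/sum_submodP; exists 0, x; rewrite rpred0 add0r. Qed.
End SumSubmod.

Lemma in_radical M x :
  x \in radical M <-> forall S : submodClosed M, maximal_submod S -> x \in S.
Proof. by split=> [/asboolP|?]; last apply/asboolP. Qed.

Lemma not_proper M (S : submodClosed M) : ~ proper_submod S -> forall x, x \in S.
Proof. by move=> nS x; apply: contrapT => /negP xS; apply: nS; exists x. Qed.

(** The preimage of a maximal submodule is maximal unless it is everything. *)
Lemma radical_map M N (f : {linear M -> N}) x :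
  x \in radical M -> f x \in radical N.
Proof.
move=> /in_radical xJ; apply/in_radical => S [_ Smax].
apply: contrapT => /negP fxS; suff : x \in preim_submod f S.
  by rewrite in_preim; apply/negP.
apply: xJ; split=> [|T [z zT] ST t tT]; first by exists x; rewrite in_preim.
rewrite in_preim; have [Uprop|/not_proper Uall] :=
  pselect (proper_submod (sum_submod S (image_submod f T))).
  apply: (Smax _ Uprop) (@sum_submodl _ _ _) _ _; apply: sum_submodr.
  by apply/image_submodP; exists t.
have /sum_submodP[s [_ [sS /image_submodP[t' t'T ->] fz]]] := Uall (f z).
case/negP: zT; rewrite -(subrK t' z) rpredD //; apply: ST.
by rewrite in_preim linearB fz addrK.
Qed.

(** A maximal submodule without x would, together with the superfluous kernel,
    span everything. *)
Lemma superfluous_radical M N (p : {linear M -> N}) x :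
  superfluous [set x | p x = 0] -> p x = 0 -> x \in radical M.
Proof.
move=> psup px0; apply/in_radical => S [[z zS] Smax].
have xT : x \in sum_submod S (kernel p) by apply/sum_submodr/kernelP.
have [Tprop|/not_proper Tall] := pselect (proper_submod (sum_submod S (kernel p))).
  exact: (Smax _ Tprop) (@sum_submodl _ _ _) _ xT.
case/negP: zS; apply: psup => y.
have /sum_submodP[s [t [sS /kernelP pt ->]]] := Tall y.
by exists t, s; rewrite addrC.
Qed.

(** For the rings of interest, the finitely generated modules of this kind are
    the finitely generated semisimple ones. *)
Definition radical_free M := forall x : M, x \in radical M -> x = 0.

Lemma radical_free_quotient M : radical_free (quotmod (radical M)).
Proof.
move=> y; have [v <-] := quotient_map_surj y => vJ.
apply/quotient_map_eq0/in_radical => S maxS; have [[z zS] Smax] := maxS.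
have JS : {subset radical M <= S} by move=> x /in_radical/(_ _ maxS).
set q := quotient_map (radical M) in vJ.
have memS w : (q w \in image_submod q S) = (w \in S).
  apply/image_submodP/idP => [[s sS] /quotient_map_eq /JS|]; last by exists w.
  by move=> /rpredD /(_ sS); rewrite subrK.
rewrite -memS; move/in_radical: vJ; apply; split; first by exists (q z); rewrite memS.
move=> T [t tT] ST u; have [w <-] := quotient_map_surj u; rewrite -/q memS => wT.
apply: (Smax (preim_submod q T)); last by rewrite in_preim.
  by have [z' zt] := quotient_map_surj t; exists z'; rewrite in_preim zt.
by move=> s; rewrite in_preim -memS; apply: ST.
Qed.

Lemma radical_free_inj M N (f : {linear M -> N}) :
  injective f -> radical_free N -> radical_free M.
Proof.
by move=> finj N0 x xJ; apply: (injective_eq0 finj); apply/N0/radical_map.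
Qed.

Lemma radical_free_ffun (I : finType) M :
  radical_free M -> radical_free {ffun I -> M}.
Proof.
move=> M0 v vJ; apply/ffunP => i; rewrite ffunE.
exact/M0/(radical_map (proj_map M i) vJ).
Qed.

(** Maximal submodules in terms of surjective maps alone, a form that an
    equivalence of categories preserves. *)
Definition simple_quotient M Q (p : {linear M -> Q}) :=
  [/\ surjective p, exists x, p x <> 0 &
      forall N (h : {linear Q -> N}), surjective h ->
        (forall y, h y = 0) \/ injective h].

Lemma simple_quotient_maximal M Q (p : {linear M -> Q}) :
  simple_quotient p -> maximal_submod (kernel p).
Proof.
move=> [psurj [x px] psimple]; split; first by exists x; apply/kernelP.
move=> T [z zT] kerT t tT.
have [h hE] := factor_surj psurj (h := quotient_map T)
  (fun w w0 => (quotient_map_eq0 T w).2 (kerT _ (introT (kernelP p w) w0))).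
have hsurj : surjective h.
  by move=> y; have [w <-] := quotient_map_surj y; exists (p w); rewrite hE.
case: (psimple _ h hsurj) => [h0|hinj].
  by case/negP: zT; apply/quotient_map_eq0; rewrite -hE h0.
by apply/kernelP/(injective_eq0 hinj); rewrite hE; apply/quotient_map_eq0.
Qed.

Lemma maximal_simple_quotient M (S : submodClosed M) :
  maximal_submod S -> simple_quotient (quotient_map S).
Proof.
move=> [[z zS] Smax]; split; first exact: quotient_map_surj.
  by exists z => /quotient_map_eq0; apply/negP.
move=> N h hsurj.
have [Tprop|/not_proper Tall] := pselect (proper_submod (kernel (h \o quotient_map S))).
  right; apply: linear_injective => y; have [w <-] := quotient_map_surj y.
  move=> hw; apply/quotient_map_eq0/(Smax _ Tprop); last exact/kernelP.
  by move=> s /quotient_map_eq0 s0; apply/kernelP; rewrite /= s0 linear0.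
left=> y; have [w <-] := quotient_map_surj y.
by have /kernelP := Tall w.
Qed.

Lemma radical_freeP M :
  radical_free M <->
  forall x : M, x <> 0 -> exists Q (p : {linear M -> Q}), simple_quotient p /\ p x <> 0.
Proof.
split=> [M0 x x0|Msep x /in_radical xJ].
  apply: contrapT => no; apply/x0/M0/in_radical => S Smax; apply/quotient_map_eq0.
  apply: contrapT => xS; apply: no; exists (quotmod S), (quotient_map S).
  by split; first exact: maximal_simple_quotient.
apply: contrapT => /Msep[Q [p [/simple_quotient_maximal pmax]]]; apply.
exact/kernelP/xJ.
Qed.

Lemma projective_split P M (p : {linear M -> P}) :
  projective P -> surjective p -> exists s : {linear P -> M}, forall x, p (s x) = x.
Proof. by move=> Pproj /(Pproj _ _ p idfun). Qed.

Lemma projective_retract P Q (s : {linear P -> Q}) (p : {linear Q -> P}) :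
  (forall x, p (s x) = x) -> projective Q -> projective P.
Proof.
move=> ps Qproj M N q f /(Qproj _ _ q (f \o p))[g gE].
by exists (g \o s) => x; rewrite /= -[LHS]/((q \o g) (s x)) gE /= ps.
Qed.

(** Lifts of generators of M generate P up to the kernel, which is superfluous. *)
Lemma projective_cover_fin_gen M P (p : {linear P -> M}) :
  projective_cover p -> fin_gen M -> fin_gen P.
Proof.
move=> [_ psurj psup] [n [m mP]].
have [l lE] := choice (fun i => psurj (m i)).
suff lP : forall x, x \in span l by exists n, l => x; apply/spanP.
apply: psup => x; have [a pxE] := mP (p x).
exists (x - \sum_i a i *: l i), (\sum_i a i *: l i); split.
- rewrite /= linearB linear_sum pxE; apply/eqP; rewrite subr_eq0; apply/eqP.
  by apply: eq_bigr => i _; rewrite linearZ /= lE.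
- by apply: rpred_sum => i _; apply/rpredZ/mem_span.
- by rewrite subrK.
Qed.

(** M is a direct summand of a finite power of N, with the inclusion and the
    projection given by their components. *)
Definition retract_of_power M N :=
  exists (I : finType) (a : I -> {linear M -> N}) (b : I -> {linear N -> M}),
    forall x, x = \sum_i b i (a i x).

Lemma retract_iso M N M' (u : {linear M -> M'}) (v : {linear M' -> M}) :
  cancel v u -> retract_of_power M N -> retract_of_power M' N.
Proof.
move=> vu [I [a [b abE]]]; exists I, (fun i => a i \o v), (fun i => u \o b i) => x.
by rewrite -[LHS]vu [v x]abE linear_sum.
Qed.

Lemma projective_fin_gen_retract P :
  projective P -> fin_gen P -> retract_of_power P (R^o).
Proof.
move=> Pproj /fin_genP[n [p psurj]].
have [s sE] := projective_split Pproj psurj.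
exists 'I_n, (fun i => proj_map (R^o) i \o s), (fun i => p \o inj_map (R^o) i).
by move=> x; rewrite -[LHS]sE {1}[s x]ffun_sum_inj linear_sum.
Qed.

Section Semiperfect.
Hypothesis R_semiperfect : semiperfect R.

(** A projective cover P -> Q lifts to P -> M; the lift kills the kernel of the
    cover, which lies in the radical of P, and so descends to Q. *)
Lemma radical_free_split M Q (p : {linear M -> Q}) :
  fin_gen M -> radical_free M -> surjective p ->
  exists s : {linear Q -> M}, forall y, p (s y) = y.
Proof.
move=> Mfg M0 psurj.
have [P [c [Pproj csurj csup]]] := R_semiperfect (fin_gen_surj psurj Mfg).
have [t tE] := Pproj _ _ p c psurj.
have [x cx|s sE] := factor_surj csurj (h := t).
  exact/M0/radical_map/(superfluous_radical csup).
by exists s => y; have [x <-] := csurj y; rewrite sE; exact: tE.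
Qed.

Lemma fin_gen_top : fin_gen (top R).
Proof. exact: fin_gen_surj (@quotient_map_surj _ _ _) (fin_gen_regular R). Qed.

Lemma radical_free_top : radical_free (top R).
Proof. exact: radical_free_quotient. Qed.

Lemma fin_gen_top_power (I : finType) : fin_gen {ffun I -> top R}.
Proof.
pose q := tuple_map (fun i : I => quotient_map (jacobson R) \o proj_map (R^o) (enum_rank i)).
apply/fin_genP; exists #|I|, q => v.
have [w wE] := choice (fun i => quotient_map_surj (v i)).
exists [ffun k => w (enum_val k)]; apply/ffunP => i.
by rewrite tuple_mapE /= ffunE enum_rankK wE.
Qed.

Lemma top_power_retraction (I : finType) N (j : {linear N -> {ffun I -> top R}}) :
  injective j -> exists r : {linear {ffun I -> top R} -> N}, forall x, r (j x) = x.
Proof.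
move=> jinj; pose q := quotient_map (range_submod j).
have [s sE] := radical_free_split (@fin_gen_top_power I)
  (radical_free_ffun radical_free_top) (@quotient_map_surj _ _ (range_submod j)).
have [|r rE] := corestrict (h := idfun \- (s \o q)) jinj.
  by move=> v; apply/range_submodP/quotient_map_eq; rewrite sE.
exists r => x; apply: jinj; rewrite rE /=.
have -> : q (j x) = 0 by apply/quotient_map_eq0/range_submodP; exists x.
by rewrite linear0 subr0.
Qed.

(** A generator of M gives a map R -> M which kills the Jacobson radical, so M is
    a quotient, hence a summand, of a finite power of R/J. *)
Lemma radical_free_retract M :
  fin_gen M -> radical_free M -> retract_of_power M (top R).
Proof.
move=> [n [m mP]] M0.
have bP i : exists b : {linear top R -> M},
    forall a : R^o, b (quotient_map (jacobson R) a) = smulr_map (m i) a.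
  apply: factor_surj; first exact: quotient_map_surj.
  by move=> a /quotient_map_eq0 aJ; exact/M0/radical_map.
have [b bE] := choice bP.
pose p := sum_map (fun i => b i \o proj_map (top R) i).
have psurj : surjective p.
  move=> x; have [a ->] := mP x.
  exists [ffun i => quotient_map (jacobson R) (a i)]; rewrite sum_mapE.
  by apply: eq_bigr => i _; rewrite /= ffunE bE.
have [s sE] := radical_free_split (@fin_gen_top_power _)
  (radical_free_ffun radical_free_top) psurj.
exists 'I_n, (fun i => proj_map (top R) i \o s), b => x.
by rewrite -[LHS]sE sum_mapE.
Qed.

End Semiperfect.
End Radical.

(** * Syzygies up to projective summands *)

Section Syzygies.
Variable R : pzRingType.
Implicit Types (L M N P Q V W X Y Z : lmodType R).

(** W is a direct summand of the sum of a projective module and a finite power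
    of V. *)
Definition stable_retract W V :=
  exists (I : finType) (a : I -> {linear W -> V}) (b : I -> {linear V -> W})
         (L : lmodType R) (c : {linear W -> L}) (d : {linear L -> W}),
    projective L /\ forall w, w = \sum_i b i (a i w) + d (c w).

Lemma projective0 L : (forall x : L, x = 0) -> projective L.
Proof.
by move=> L0 M N p f _; exists \0 => x; rewrite /= (L0 x) !linear0.
Qed.

Lemma retract_stable_retract W V : retract_of_power W V -> stable_retract W V.
Proof.
move=> [I [a [b abE]]].
exists I, a, b, {ffun 'I_0 -> R^o}, \0, \0; split=> [|w]; last by rewrite addr0.
by apply: projective0 => v; apply/ffunP => - [].
Qed.

Lemma stable_retract_iso W V (u : {linear W -> V}) (v : {linear V -> W}) :
  (forall w, v (u w) = w) -> stable_retract W V.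
Proof.
move=> vu; apply: retract_stable_retract.
by exists 'I_1, (fun=> u), (fun=> v) => w; rewrite big_ord1 vu.
Qed.

Lemma stable_retract_refl W : stable_retract W W.
Proof. exact: (@stable_retract_iso _ _ idfun idfun). Qed.

Definition is_syzygy W N :=
  exists (L : lmodType R) (e : {linear L -> W}) (k : {linear N -> L}),
    [/\ projective L, surjective e, injective k &
        forall x, e x = 0 <-> exists y, x = k y].

Fixpoint nth_syzygy n X W : Prop :=
  if n is m.+1 then exists V, nth_syzygy m X V /\ is_syzygy V W else X = W.

(** The maps of a stable retraction lift to projective presentations e and e'
    of its two modules; what the lifts miss of the identity is a map theta into
    the kernel of e. *)
Lemma stable_retract_lift L W (e : {linear L -> W}) L' V (e' : {linear L' -> V}) :
  projective L -> surjective e -> projective L' -> surjective e' ->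
  stable_retract W V ->
  exists (I : finType) (a : I -> {linear W -> V}) (b : I -> {linear V -> W})
    (A : I -> {linear L -> L'}) (B : I -> {linear L' -> L}) (theta : {linear L -> L}),
    [/\ forall i x, e' (A i x) = a i (e x),
        forall i x, e (B i x) = b i (e' x),
        forall x, e (theta x) = 0 &
        forall x, e x = 0 -> x = \sum_i B i (A i x) + theta x].
Proof.
move=> Lproj esurj L'proj e'surj [I [a [b [T [c [d [Tproj abcd]]]]]]].
have [A AE] := choice (fun i => Lproj _ _ e' (a i \o e) e'surj).
have [B BE] := choice (fun i => L'proj _ _ e (b i \o e') esurj).
have [D DE] := Tproj _ _ e d esurj.
exists I, a, b, A, B, (idfun \- (sum_map (fun i => B i \o A i) \+ (D \o c \o e))).
split=> [i x|i x|x|x x0]; [exact: AE|exact: BE| |].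
  rewrite /= linearB linearD linear_sum [e (D _)]DE {1}[e x]abcd.
  apply/eqP; rewrite subr_eq0; apply/eqP; congr (_ + _).
  by apply: eq_bigr => i _; rewrite [RHS]BE /= [e' _]AE.
by rewrite /= x0 !linear0 addr0 addrC subrK.
Qed.

(** A form of the comparison theorem for projective resolutions. *)
Lemma stable_retract_syzygy W V N N' :
  stable_retract W V -> is_syzygy W N -> is_syzygy V N' -> stable_retract N N'.
Proof.
move=> WV [L [e [k [Lproj esurj kinj ek]]]] [L' [e' [k' [L'proj e'surj k'inj ek']]]].
have [I [a [b [A [B [theta [AE BE etheta eq_theta]]]]]]] :=
  stable_retract_lift Lproj esurj L'proj e'surj WV.
have kN x : e (k x) = 0 by apply/ek; exists x.
have k'N x : e' (k' x) = 0 by apply/ek'; exists x.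
have [t tE] := corestrict kinj (fun x => (ek _).1 (etheta x)).
have /choice[a' a'E] i : exists h : {linear N -> N'}, forall x, k' (h x) = A i (k x).
  by apply: (corestrict (h := A i \o k)) => // x; apply/ek'; rewrite AE kN linear0.
have /choice[b' b'E] i : exists h : {linear N' -> N}, forall x, k (h x) = B i (k' x).
  by apply: (corestrict (h := B i \o k')) => // x; apply/ek; rewrite BE k'N linear0.
exists I, a', b', L, k, t; split=> // x; apply: kinj.
rewrite linearD linear_sum tE {1}(eq_theta (k x)) //; congr (_ + _).
by apply: eq_bigr => i _; rewrite b'E a'E.
Qed.

Lemma stable_retract_nth_syzygy n X X' W V :
  stable_retract X X' -> nth_syzygy n X W -> nth_syzygy n X' V ->
  stable_retract W V.
Proof.
move=> XX'; elim: n W V => [W V <- <- //|n IHn W V].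
move=> [W0 [XW0 W0W]] [V0 [XV0 V0V]].
exact: stable_retract_syzygy (IHn _ _ XW0 XV0) W0W V0V.
Qed.

(** * Extensions pulled back from powers of a module *)

(** For e surjective with projective source, the maps from the kernel of e to
    Z, modulo those defined on all of L, form Ext^1(W, Z). The condition says
    that each class of Ext^1(W, Z) vanishes on the common kernel of finitely
    many maps W -> Y. The map on the kernel and its extension are carried by
    arbitrary functions on L that are linear where it matters. *)
Definition ext1_dies L W (e : {linear L -> W}) Y Z :=
  forall f : L -> Z, linear_on [set x | e x = 0] f ->
  exists (I : finType) (s : I -> {linear W -> Y}) (g : L -> Z),
    linear_on [set x | forall i, s i (e x) = 0] g /\
    forall x, e x = 0 -> g x = f x.

(** Transport f along each b_i, extend the result for V, pull it back along a_i
    and add what f does on the defect theta. *)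
Lemma ext1_dies_stable_retract L W (e : {linear L -> W})
    L' V (e' : {linear L' -> V}) Y Z :
  projective L -> surjective e -> projective L' -> surjective e' ->
  stable_retract W V -> ext1_dies e' Y Z -> ext1_dies e Y Z.
Proof.
move=> Lproj esurj L'proj e'surj WV diesV f fL.
have [I [a [b [A [B [theta [AE BE etheta eq_theta]]]]]]] :=
  stable_retract_lift Lproj esurj L'proj e'surj WV.
have fBL i : linear_on [set x | e' x = 0] (f \o B i).
  by move=> k u v u0 v0 /=; rewrite linearP fL //= BE (u0, v0) linear0.
have /choice[J JP] : forall i, exists J : {J : finType &
      ((J -> {linear V -> Y}) * (L' -> Z))%type},
    linear_on [set x | forall j, (projT2 J).1 j (e' x) = 0] (projT2 J).2 /\
    forall x, e' x = 0 -> (projT2 J).2 x = f (B i x).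
  by move=> i; have [J [s [g]]] := diesV _ (fBL i); exists (existT _ J (s, g)).
pose s i := (projT2 (J i)).1; pose g i := (projT2 (J i)).2.
exists {i : I & projT1 (J i)}, (fun ij => s (tag ij) (tagged ij) \o a (tag ij)).
exists (fun x => \sum_i g i (A i x) + f (theta x)); split=> [k u v uS vS|x x0].
  rewrite linearP fL; [|exact: etheta|exact: etheta].
  rewrite scalerDr addrACA scaler_sumr -big_split /=; congr (_ + _).
  apply: eq_bigr => i _; rewrite linearP; have [gL _] := JP i.
  apply: gL => j /=; rewrite AE; 
    [exact: (uS (Tagged (fun i => projT1 (J i)) j))
    |exact: (vS (Tagged (fun i => projT1 (J i)) j))].
have BA0 i : e (B i (A i x)) = 0 by rewrite BE AE x0 !linear0.
have BAs0 : e (\sum_i B i (A i x)) = 0 by rewrite linear_sum big1.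
rewrite [in RHS](eq_theta _ x0) (linear_onD fL) ?etheta // (linear_on_ker_sum fL) //.
congr (_ + _); apply: eq_bigr => i _; have [_ gE] := JP i.
by apply: gE; rewrite AE x0 linear0.
Qed.

(** The coordinates of f in Z' die separately; the finite families of test maps
    are put together. *)
Lemma retract_ext1_dies_coef L W (e : {linear L -> W}) Y Z Z' :
  retract_of_power Z Z' -> ext1_dies e Y Z' -> ext1_dies e Y Z.
Proof.
move=> [I [a [b abE]]] diesZ' f fL.
have afL i : linear_on [set x | e x = 0] (a i \o f).
  by move=> k u v u0 v0 /=; rewrite fL // linearP.
have /choice[J JP] : forall i, exists J : {J : finType &
      ((J -> {linear W -> Y}) * (L -> Z'))%type},
    linear_on [set x | forall j, (projT2 J).1 j (e x) = 0] (projT2 J).2 /\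
    forall x, e x = 0 -> (projT2 J).2 x = a i (f x).
  by move=> i; have [J [s [g]]] := diesZ' _ (afL i); exists (existT _ J (s, g)).
pose s i := (projT2 (J i)).1; pose g i := (projT2 (J i)).2.
exists {i : I & projT1 (J i)}, (fun ij => s (tag ij) (tagged ij)).
exists (fun x => \sum_i b i (g i x)); split=> [k u v uS vS|x x0].
  rewrite scaler_sumr -big_split /=; apply: eq_bigr => i _; rewrite -linearP.
  have [gL _] := JP i; congr (b i _).
  by apply: gL => j;
    [exact: (uS (Tagged (fun i => projT1 (J i)) j))
    |exact: (vS (Tagged (fun i => projT1 (J i)) j))].
rewrite [RHS]abE; apply: eq_bigr => i _; have [_ gE] := JP i.
by congr (b i _); apply: gE.
Qed.

Lemma retract_ext1_dies_test L W (e : {linear L -> W}) Y Y' Z :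
  retract_of_power Y Y' -> ext1_dies e Y Z -> ext1_dies e Y' Z.
Proof.
move=> [I [a [b abE]]] dies f fL.
have [J [s [g [gL gf]]]] := dies f fL.
exists (J * I)%type, (fun ji => a ji.2 \o s ji.1), g; split=> // k u v uS vS.
by apply: gL => j; rewrite [LHS]abE big1 // => i _;
  [have := uS (j, i)|have := vS (j, i)]; rewrite /= => ->; rewrite linear0.
Qed.

End Syzygies.

(** * The Yoneda product with a class of degree one *)

Section YonedaProduct.
Variables (K : fieldType) (B : algType K).
Implicit Types (X Y Z : lmodType B).

Section Resolutions.
Variables (X Y Z : lmodType B) (P : resolution X) (Q : resolution Y).

Lemma res_diffK n x : res_diff P n (res_diff P n.+1 x) = 0.
Proof. by apply/res_exactS; exists x. Qed.

Lemma coboundary_lift n (f : Hom (P n) Y) :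
  coboundary_set f ->
  exists h : {linear P n -> Q 0}, (forall x, res_aug Q (h x) = f x) /\
    forall x, h (res_diff P n x) = 0.
Proof.
case: n f => [|n] f; first by move=> /= ->; exists \0; split=> // x; exact: linear0.
move=> [g fg]; have [h hE] := @res_proj _ _ _ P n _ _ (res_aug Q) g (@res_aug_surj _ _ _ Q).
exists (h \o res_diff P n); split=> x /=; last by rewrite res_diffK linear0.
by rewrite fg; exact: hE.
Qed.

Lemma cocycle_boundary n (c : cocycle P Y n) x : val c (res_diff P n x) = 0.
Proof. exact: cocycleP. Qed.

End Resolutions.

Lemma repr_pi_coboundary X Y (P : resolution X) n (c : cocycle P Y n) :
  coboundary_set (val (repr (quot_pi (coboundaries P Y n) c)) - val c).
Proof.
have : quot_pi (coboundaries P Y n) (repr (quot_pi (coboundaries P Y n) c)) ==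
    quot_pi (coboundaries P Y n) c.
  by apply/eqP; exact: reprK.
by rewrite quot_pi_eq => /asboolP.
Qed.

(** The product of two classes may be computed from any representatives and
    from any lift: two lifts of cohomologous cocycles differ, up to a map that
    kills boundaries, by a homotopy. *)
Lemma yoneda_representatives X Y Z (P : resolution X) (Q : resolution Y) i
    (a : cocycle P Y i) (b : cocycle Q Z 1)
    (p0 : {linear P i -> Q 0}) (p1 : {linear P i.+1 -> Q 1}) :
  (forall x, res_aug Q (p0 x) = val a x) ->
  (forall x, res_diff Q 0 (p1 x) = p0 (res_diff P i x)) ->
  exists t : {linear P i -> Z}, forall x,
    val (yoneda_cocycle (repr (quot_pi (coboundaries P Y i) a))
           (repr (quot_pi (coboundaries Q Z 1) b))) x =
    val b (p1 x) + t (res_diff P i x).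
Proof.
move=> p0E p1E.
have [h [hE hd]] := coboundary_lift Q (repr_pi_coboundary a).
have [g gE] := repr_pi_coboundary b.
set a' := repr _ in hE *; set b' := repr _ in gE *.
have {}hE x : res_aug Q (h x) = val a' x - val a x by exact: hE.
have {}gE x : val b' x = g (res_diff Q 0 x) + val b x.
  by rewrite -[g _]gE; exact: esym (subrK _ _).
have [q0E q1E] := chain_liftP Q a'.
set q := chain_lift Q a' in q0E q1E.
have [t tE] : exists t : {linear P i -> Q 1}, forall x,
    res_diff Q 0 (t x) = (q 0%N \- p0 \- h) x.
  apply: projective_lift; first exact: res_proj.
  by move=> x; apply/res_exact0; rewrite /= !linearB q0E p0E hE subrr.
exists (((val b : {linear _ -> _}) \o t) \+ ((g : {linear _ -> _}) \o q 0%N)) => x.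
rewrite -[LHS]/(val b' (q 1%N x)) gE q1E /= [RHS]addrA [RHS]addrC; congr (_ + _).
apply/eqP; rewrite -subr_eq0 -linearD -linearB; apply/eqP.
have [|y ->] := (@res_exactS _ _ _ Q 0 (q 1%N x - (p1 x + t (res_diff P i x)))).1.
  by rewrite linearB linearD q1E p1E tE /= hd subr0 [p0 _ + _]addrC subrK subrr.
exact: cocycle_boundary.
Qed.

Lemma hom_sumE X Y (I : finType) (f : I -> Hom X Y) x :
  (\sum_j f j) x = \sum_j f j x.
Proof. by elim/big_ind2: _ => // _ u _ v <- <-. Qed.

(** * The criterion for products with classes of degree one to be everything *)

Section Criterion.
Variables (X Y Z : lmodType B) (i : nat).
Let W := iter i (@syzygy K B) X.
Let P := free_resolution X.
Let Q := free_resolution Y.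

(** A class in Ext^i(X, Y) is given by a map s_j : W -> Y. On the part of the
    projective covering W that s_j sends to 0, the lift p_j of s_j takes values
    in the first syzygy of Y, where a cocycle b_j of degree one is defined: so
    the product of the two extends to that part. *)
Lemma ext_prod_ext1_dies :
  @ext_prod _ _ i 1 X Y Z setT setT = setT -> ext1_dies (free_aug W) Y Z.
Proof.
move=> prodT f fL.
have dW x : free_aug W (res_diff P i x) = 0.
  by apply: (@free_res_exact _ _ X i _).2; exists x.
have cL : linear (f \o res_diff P i).
  by move=> k u v /=; rewrite linearP fL //; exact: dW.
have cZ : @cocycle_set _ _ _ P Z i.+1 (mk_linear cL).
  move=> x; rewrite -[LHS]/(f (res_diff P i (res_diff P i.+1 x))) res_diffK.
  by apply: (linear_on0 fL); exact: linear0.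
pose c : cocycle P Z i.+1 := Cocycle cZ.
have : [set: Ext (1 + i) X Z] (quot_pi _ c) by [].
rewrite -prodT => - [n [k [z [zP cE]]]].
have /choice[xi /choice[zeta zE]] : forall j : 'I_n, exists xi : Ext i X Y,
    exists zeta : Ext 1 Y Z, z j = yoneda xi zeta.
  by move=> j; have [xi [zeta [_ _ ->]]] := zP j; exists xi, zeta.
pose a j : cocycle P Y i := repr (xi j).
pose b j : cocycle Q Z 1 := repr (zeta j).
have [h hE] : exists h : Hom (P i) Z, forall x,
    val c x = h (res_diff P i x) + \sum_j (k j)%:A *: val (b j) (chain_lift Q (a j) 1 x).
  have : quot_pi (coboundaries P Z i.+1) c ==
      quot_pi (coboundaries P Z i.+1) (\sum_j k j *: yoneda_cocycle (a j) (b j)).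
    rewrite cE linear_sum; apply/eqP; apply: eq_bigr => j _.
    by rewrite linearZ zE.
  rewrite quot_pi_eq => /asboolP[h hE]; exists h => x.
  rewrite -[h _]hE linearB linear_sum.
  have -> : (val c - \sum_j val (k j *: yoneda_cocycle (a j) (b j))) x =
     val c x - \sum_j val (k j *: yoneda_cocycle (a j) (b j)) x.
    congr (_ - _); exact: hom_sumE.
  exact: esym (subrK _ _).
have [s sE] : exists s : 'I_n -> {linear W -> Y},
    forall j x, s j (free_aug W x) = val (a j) x.
  suff /choice[s sE] : forall j, exists s : {linear W -> Y},
    forall x, s (free_aug W x) = val (a j) x by exists s.
  move=> j; apply: (factor_surj (h := val (a j))); first exact: free_aug_surj.
  by move=> x /(@free_res_exact _ _ X i)[y ->]; exact: cocycle_boundary.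
have /choice[bd bdE] : forall j, exists bd : Q 0%N -> Z,
    forall y, bd (res_diff Q 0 y) = val (b j) y.
  move=> j; apply: (descend (p := res_diff Q 0) (h := val (b j))) => y.
  by move=> /(@res_exactS _ _ _ Q)[y' ->]; exact: cocycle_boundary.
pose p0 j : {linear P i -> Q 0} := chain_lift Q (a j) 0.
have p0E j x : res_aug Q (p0 j x) = val (a j) x.
  by have [+ _] := chain_liftP Q (a j); apply.
exists 'I_n, s, (fun x => h x + \sum_j (k j)%:A *: bd j (p0 j x)); split.
  move=> l u v uS vS; rewrite linearP scalerDr [RHS]addrACA; congr (_ + _).
  rewrite scaler_sumr -big_split /=; apply: eq_bigr => j _; rewrite linearP.
  rewrite (descend_linear_on (bdE j)).
  - by rewrite scalerDr !scalerA mulr_algl mulr_algr.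
  - by apply/(@res_exact0 _ _ _ Q); rewrite p0E -sE uS.
  - by apply/(@res_exact0 _ _ _ Q); rewrite p0E -sE vS.
move=> x /(@free_res_exact _ _ X i)[y ->]; rewrite -[RHS]/(val c y) hE; congr (_ + _).
apply: eq_bigr => j _; congr (_ *: _).
have [_ q1E] := chain_liftP Q (a j).
by rewrite -[RHS]bdE q1E.
Qed.

Lemma lin_span_sum (V : lmodType K) (S : set V) (I : finType) (v : I -> V) :
  (forall j, S (v j)) -> lin_span S (\sum_j v j).
Proof.
move=> vS; exists #|I|, (fun=> 1), (fun k => v (enum_val k)); split=> //.
rewrite (reindex (@enum_val I predT)) /=; last first.
  by apply: onW_bij; exact: enum_val_bij.
by apply: eq_bigr => k _; rewrite scale1r.
Qed.

(** The hypothesis on Y holds when its finite powers are semisimple. For maps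
    s_j : W -> Y with common kernel V it gives maps r_j : Y -> W/V such that
    sum_j r_j s_j is the quotient map; they lift to maps v_j from the projective
    covering Y to the one covering W. When f extends to g on the preimage of V,
    the cocycles g o v_j represent classes in Ext^1(Y, Z) and the product with
    the classes of the s_j makes up f, since x - sum_j v_j (p_j x) lies in the
    preimage of V for p_j a lift of s_j. *)
Lemma ext1_dies_ext_prod :
  (forall (I : finType) (N : lmodType B) (j : {linear N -> {ffun I -> Y}}), injective j ->
     exists r : {linear {ffun I -> Y} -> N}, forall x, r (j x) = x) ->
  ext1_dies (free_aug W) Y Z ->
  @ext_prod _ _ i 1 X Y Z setT setT = setT.
Proof.
move=> Ysplit dies; rewrite -subTset => xi _.
pose c := repr xi; have xiE : xi = quot_pi (coboundaries P Z i.+1) c.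
  by apply: esym; exact: reprK.
have [|f fE] := descend (p := res_diff P i) (h := val c).
  by move=> y /(@res_exactS _ _ _ P)[y' ->]; exact: cocycle_boundary.
have fL : linear_on [set x | free_aug W x = 0] f.
  move=> k u v u0 v0; apply: (descend_linear_on fE).
  exact: (@free_res_exact _ _ X i _).1.
  exact: (@free_res_exact _ _ X i _).1.
have [I [s [g [gL gf]]]] := dies f fL.
pose V := kernel (tuple_map s).
have inV w : w \in V <-> forall j, s j w = 0.
  split=> [/kernelP sw0 j|sw0]; first by rewrite -[LHS](tuple_mapE s) sw0 ffunE.
  by apply/kernelP/ffunP => j; rewrite tuple_mapE sw0 ffunE.
pose q := quotient_map V.
have [sb sbE] := factor_surj (@quotient_map_surj _ _ V) (h := tuple_map s)
  (fun w w0 => elimT (kernelP _ w) ((quotient_map_eq0 V w).1 w0)).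
have [|r rE] := Ysplit I _ sb.
  apply: linear_injective => y; have [w <-] := quotient_map_surj y.
  by rewrite sbE => sw0; apply/quotient_map_eq0/kernelP.
have rsE w : \sum_j r (inj_map Y j (s j w)) = q w.
  rewrite -[RHS]rE sbE [in RHS](ffun_sum_inj (tuple_map s w)) linear_sum.
  by apply: eq_bigr => j _; rewrite tuple_mapE.
have qe_surj : surjective (q \o free_aug W).
  move=> y; have [w <-] := quotient_map_surj y.
  by have [x <-] := free_aug_surj w; exists x.
have /choice[v vE] : forall j, exists v : {linear Q 0%N -> P i},
    forall y, q (free_aug W (v y)) = r (inj_map Y j (res_aug Q y)).
  move=> j; have [v vE] := @free_projective _ _ _ _ _ (q \o free_aug W)
    (r \o inj_map Y j \o res_aug Q) qe_surj.
  by exists v.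
have dP x : free_aug W (res_diff P i x) = 0.
  by apply: (@free_res_exact _ _ X i _).2; exists x.
have aZ j : @cocycle_set _ _ _ P Y i (s j \o free_aug W).
  by move=> x; rewrite -[LHS]/(s j (free_aug W (res_diff P i x))) dP linear0.
pose a j : cocycle P Y i := Cocycle (aZ j).
pose p0 j : {linear P i -> Q 0%N} := chain_lift Q (a j) 0.
pose p1 j : {linear P i.+1 -> Q 1%N} := chain_lift Q (a j) 1.
have p0E j x : res_aug Q (p0 j x) = s j (free_aug W x).
  by have [+ _] := chain_liftP Q (a j); apply.
have p1E j x : res_diff Q 0 (p1 j x) = p0 j (res_diff P i x).
  by have [_ /(_ 0%N x)] := chain_liftP Q (a j).
pose M : set (P i) := [set x | forall j, s j (free_aug W x) = 0].
have inM x : M x <-> q (free_aug W x) = 0.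
  by rewrite quotient_map_eq0 inV.
have vdM j y : M (v j (res_diff Q 0 y)).
  apply/inM; rewrite vE; have -> : res_aug Q (res_diff Q 0 y) = 0.
    by apply/res_exact0; exists y.
  by rewrite !linear0.
have bL j : linear (fun y => g (v j (res_diff Q 0 y))).
  by move=> k u u'; rewrite !linearP gL //; exact: vdM.
have bZ j : @cocycle_set _ _ _ Q Z 1 (mk_linear (bL j)).
  move=> y; rewrite -[LHS]/(g (v j (res_diff Q 0 (res_diff Q 1 y)))) res_diffK.
  by rewrite linear0 (linear_on0 gL) // => j'; rewrite !linear0.
pose b j : cocycle Q Z 1 := Cocycle (bZ j).
(* the correction of x that lies in the preimage M of V *)
pose rest x := x - \sum_j v j (p0 j x).
have restM x : M (rest x).
  apply/inM; rewrite /rest linearB linear_sum linearB linear_sum.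
  apply/eqP; rewrite subr_eq0 -rsE; apply/eqP.
  by apply: eq_bigr => j _; rewrite vE p0E.
have hL : linear (fun x => g (rest x)).
  move=> k x y; rewrite -gL; [congr g|exact: restM|exact: restM].
  rewrite /rest scalerBr addrACA -opprD.
  congr (_ - _); rewrite scaler_sumr -big_split /=.
  by apply: eq_bigr => j _; rewrite !linearP.
have [t tE] := choice (fun j => yoneda_representatives (a := a j) (b j)
  (p0E j) (p1E j)).
pose z j : Ext (1 + i) X Z := yoneda
  (quot_pi (coboundaries P Y i) (a j)) (quot_pi (coboundaries Q Z 1) (b j)).
suff -> : xi = \sum_j z j.
  by apply: lin_span_sum => j; exists (quot_pi _ (a j)), (quot_pi _ (b j)).
have gL' : linear_on [set x | (q \o free_aug W) x = 0] g.
  by move=> k x y /inM xM /inM yM; apply: gL.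
have gd x : val c x = g (rest (res_diff P i x)) + \sum_j val (b j) (p1 j x).
  have vM j : M (v j (p0 j (res_diff P i x))) by rewrite -p1E; apply: vdM.
  rewrite -fE -gf // -[X in g X = _](subrK (\sum_j v j (p0 j (res_diff P i x)))).
  have v0 j : (q \o free_aug W) (v j (p0 j (res_diff P i x))) = 0 by apply/inM.
  have rest0 : (q \o free_aug W) (rest (res_diff P i x)) = 0.
    by apply/inM; exact: restM.
  rewrite (linear_onD gL' rest0) ?(linear_on_ker_sum gL' v0); last first.
    by rewrite /mkset linear_sum big1 // => j _; exact: v0.
  by congr (_ + _); apply: eq_bigr => j _; rewrite -p1E.
pose h : {linear P i -> Z} := mk_linear hL \- sum_map t.
pose yc j := yoneda_cocycle (repr (quot_pi (coboundaries P Y i) (a j)))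
  (repr (quot_pi (coboundaries Q Z 1) (b j))).
have -> : \sum_j z j = quot_pi (coboundaries P Z i.+1) (\sum_j yc j).
  by rewrite linear_sum.
apply/eqP; rewrite xiE quot_pi_eq; apply/asboolP; exists h => x.
rewrite linearB linear_sum -[RHS]/(g (rest (res_diff P i x)) - \sum_j t j (res_diff P i x)).
have -> : (val c - \sum_j val (yc j)) x = val c x - \sum_j val (yc j) x.
  by congr (_ - _); exact: hom_sumE.
rewrite (eq_bigr _ (fun j _ => tE j x)) big_split gd opprD addrA addrK.
by [].
Qed.

End Criterion.

End YonedaProduct.

(** * Equivalences of categories of modules *)

Lemma nat_iso_faithful (C D : category) (F : functor C D) (G : functor D C) :
  nat_iso (compF G F) (idF C) ->
  forall (X Y : C) (f g : hom X Y), fhom F f = fhom F g -> f = g.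
Proof.
move=> [eta [eta_iso nat]] X Y f g Ffg.
have [h [_ etah]] := eta_iso X.
have E : comp f (eta X) = comp g (eta X).
  by have := nat _ _ f; rewrite /= Ffg (nat _ _ g).
by rewrite -(compm1 f) -(compm1 g) -etah !compA E.
Qed.

Lemma equivalence_full (C D : category) (F : functor C D) : is_equivalence F ->
  forall (X Y : C) (h : hom (F X) (F Y)), exists f : hom X Y, fhom F f = h.
Proof.
move=> [G [[eta [eta_iso nat]] FG]] X Y h.
have [iX [iXl iXr]] := eta_iso X; have [iY [iYl iYr]] := eta_iso Y.
exists (comp (eta Y) (comp (fhom G h) iX)); apply: (nat_iso_faithful FG).
have := nat _ _ (comp (eta Y) (comp (fhom G h) iX)).
rewrite /= -!compA iXl compm1 => /(congr1 (comp iY)).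
by rewrite !compA iYl !comp1m.
Qed.

Section ModuleClasses.
Variable R : pzRingType.
Implicit Types M N P : lmodType R.

(** The closure properties shared by the class of all modules and the class of
    finitely generated modules. Two of them are stated for noetherian rings
    only, because the target ring of an equivalence has to be shown noetherian
    with the help of the others. *)
Record module_class (C : lmodType R -> Prop) := ModuleClass {
  class_fin_gen : forall M, fin_gen M -> C M;
  class_surj : forall M N (f : {linear M -> N}), surjective f -> C M -> C N;
  class_cover : forall M, C M ->
    exists (P : lmodType R) (p : {linear P -> M}), [/\ projective P, surjective p & C P];
  class_inj : noetherian_mod (R^o) ->
    forall M N (f : {linear N -> M}), injective f -> C M -> C N;
  class_prod : noetherian_mod (R^o) ->
    forall M N, C M -> C N -> C (M * N)%type }.

Lemma projective_free (I : finType) : projective {ffun I -> R^o}.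
Proof.
move=> M N p f psurj.
have [m mE] := choice (fun i => psurj (f (inj_map (R^o) i 1))).
exists (lin_comb m) => v; rewrite -[LHS]/(p (lin_comb m v)) lin_combE linear_sum.
rewrite [in RHS](ffun_sum_inj v) linear_sum; apply: eq_bigr => i _.
rewrite linearZ /= mE -linearZ; congr (f _); apply/ffunP => j; rewrite !ffunE.
by case: eqP => _; [exact: (mulr1 (v i : R))|rewrite scaler0].
Qed.

Lemma projective_regular : projective (R^o).
Proof.
apply: (projective_retract (s := inj_map (R^o) ord0) (p := proj_map (R^o) (ord0 : 'I_1))).
  by move=> x; rewrite /= ffunE eqxx.
exact: projective_free.
Qed.

Lemma fin_gen_class : module_class (@fin_gen R).
Proof.
split=> //.
- exact: fin_gen_surj.
- move=> M /fin_genP[n [p psurj]]; exists {ffun 'I_n -> R^o}, p; split=> //.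
    exact: projective_free.
  by apply/fin_genP; exists n, idfun => v; exists v.
- by move=> Rnoeth M N f; apply: fin_gen_inj.
- by move=> Rnoeth M N; apply: fin_gen_prod.
Qed.

End ModuleClasses.

Lemma all_modules_class (K : fieldType) (A : algType K) :
  module_class (fun _ : lmodType A => True).
Proof.
split=> // M _; exists (free_mod A M), (free_aug M); split=> //.
  exact: free_projective.
exact: free_aug_surj.
Qed.

Section Transport.
Variables (A A' : pzRingType) (C : lmodType A -> Prop) (C' : lmodType A' -> Prop).
Hypotheses (CP : module_class C) (CP' : module_class C').
Variable F : functor (@full_subcategory (Mod A) C) (@full_subcategory (Mod A') C').
Hypothesis F_equiv : is_equivalence F.

Definition obj_mod (X : @full_subcategory (Mod A) C) : lmodType A := sval X.
Definition img_mod (X : @full_subcategory (Mod A) C) : lmodType A' := sval (F X).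
Implicit Types (X Y Z : @full_subcategory (Mod A) C).
Local Notation m := obj_mod.
Local Notation m' := img_mod.

Lemma obj_modP X : C (m X). Proof. exact: svalP X. Qed.
Lemma img_modP X : C' (m' X). Proof. exact: svalP (F X). Qed.

Definition mk_obj (M : lmodType A) (CM : C M) : @full_subcategory (Mod A) C :=
  exist _ M CM.

Definition fmap X Y (f : {linear m X -> m Y}) : {linear m' X -> m' Y} :=
  @fhom _ _ F X Y f.

Lemma fmap_id X x : @fmap X X idfun x = x.
Proof.
have := fhom1 F X.
by move/(congr1 (fun h : {linear m' X -> m' X} => h x)).
Qed.

Lemma fmap_comp X Y Z (g : {linear m Y -> m Z}) (f : {linear m X -> m Y}) x :
  fmap (g \o f) x = fmap g (fmap f x).
Proof.
have := @fhomM _ _ F X Y Z g f.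
by move/(congr1 (fun h : {linear m' X -> m' Z} => h x)).
Qed.

Lemma fmap_ext X Y (f g : {linear m X -> m Y}) : f =1 g -> fmap f =1 fmap g.
Proof. by move=> /linear_ext ->. Qed.

Lemma fmap_faithful X Y (f g : {linear m X -> m Y}) :
  (forall x, fmap f x = fmap g x) -> forall x, f x = g x.
Proof.
move=> fg; have [G [GF _]] := F_equiv.
by have -> : f = g by apply: (nat_iso_faithful GF); apply: linear_ext.
Qed.

Lemma fmap_full X Y (h : {linear m' X -> m' Y}) :
  exists f : {linear m X -> m Y}, forall x, fmap f x = h x.
Proof.
have [f fE] := equivalence_full F_equiv (h : hom (F X) (F Y)).
exists f => x; exact: (congr1 (fun h : {linear m' X -> m' Y} => h x) fE).
Qed.

Lemma ess_surj (M' : lmodType A') : C' M' ->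
  exists X (u : {linear m' X -> M'}) (v : {linear M' -> m' X}),
    cancel u v /\ cancel v u.
Proof.
move=> CM'; have [G [_ [eps [eps_iso _]]]] := F_equiv.
pose X' : @full_subcategory (Mod A') C' := exist _ M' CM'.
have [v [uv vu]] := eps_iso X'; exists (G X'), (eps X'), v; split.
  by move=> x; move/(congr1 (fun h : {linear m' (G X') -> m' (G X')} => h x)): uv.
by move=> x; move/(congr1 (fun h : {linear M' -> M'} => h x)): vu.
Qed.

Lemma fmap0 X Y (f : {linear m X -> m Y}) :
  (forall x, f x = 0) -> forall z, fmap f z = 0.
Proof.
move=> f0.
have CO : C {ffun 'I_0 -> A^o}.
  apply: (class_fin_gen CP); apply/fin_genP.
  by exists 0, idfun => v; exists v.
pose O := mk_obj CO.
have O0 (v : m O) : v = 0 by apply/ffunP => - [].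
have FO0 (z : m' O) : z = 0.
  have [h hE] := fmap_full (\0 : {linear m' O -> m' O}).
  rewrite -[LHS](@fmap_id O z); transitivity (fmap h z); last exact: hE.
  apply: fmap_ext => v.
  by rewrite [LHS]O0 [RHS]O0.
move=> z; pose a : {linear m X -> m O} := \0; pose b : {linear m O -> m Y} := \0.
have /fmap_ext -> : f =1 b \o a by move=> x; rewrite f0.
by rewrite fmap_comp [fmap a z]FO0 linear0.
Qed.

(** An element z of F X is hit by a map F T -> F X whose image is generated by
    z; so what F does to elements can be tested on maps. *)
Lemma element_map X (z : m' X) :
  exists T (h : {linear m T -> m X}) (t : m' T), fmap h t = z /\
    forall Y (f : {linear m X -> m Y}), fmap f z = 0 -> forall y, f (h y) = 0.
Proof.
have [T [u [v [uv vu]]]] := ess_surj (class_fin_gen CP' (fin_gen_regular A')).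
have [h hE] := fmap_full ((smulr_map z : {linear A'^o -> m' X}) \o u : {linear m' T -> m' X}).
exists T, h, (v 1); split=> [|Y f fz0]; first by rewrite hE /= vu; exact: scale1r.
apply: (@fmap_faithful _ _ (f \o h) \0) => x.
by rewrite fmap_comp hE /= linearZ /= fz0 scaler0 fmap0.
Qed.

Lemma fmap_inj X Y (f : {linear m X -> m Y}) : injective f -> injective (fmap f).
Proof.
move=> finj; apply: linear_injective => z fz0.
have [T [h [t [zE fh0]]]] := element_map z; rewrite -zE.
by apply: fmap0 => x; apply: (injective_eq0 finj); exact: fh0.
Qed.

(** The cokernel of F f comes from a map out of the target of f that kills the
    range of f. *)
Lemma fmap_surj X Y (f : {linear m X -> m Y}) : surjective f -> surjective (fmap f).
Proof.
move=> fsurj; apply: cokernel0_surjective => y.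
set q := quotient_map _.
have [T [u [v [uv vu]]]] :=
  ess_surj (class_surj CP' (@quotient_map_surj _ _ _ : surjective q) (@img_modP Y)).
have [k kE] := fmap_full (v \o q : {linear m' Y -> m' T}).
suff k0 : forall y, k y = 0 by rewrite -[LHS]vu -[v _]kE fmap0 // linear0.
move=> y'; have [x <-] := fsurj y'; move: x {y'}.
apply: (@fmap_faithful _ _ (k \o f) \0) => x.
rewrite fmap_comp [RHS]fmap0 // kE /=.
have -> : q (fmap f x) = 0.
  by apply/quotient_map_eq0/range_submodP; exists x.
exact: linear0.
Qed.

Lemma surj_fmap X Y (f : {linear m X -> m Y}) : surjective (fmap f) -> surjective f.
Proof.
move=> Ffsurj; apply: cokernel0_surjective => y.
set q := quotient_map _.
pose T := mk_obj (class_surj CP (@quotient_map_surj _ _ _ : surjective q) (@obj_modP Y)).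
move: y; apply: (@fmap_faithful Y T q \0) => z.
have [x <-] := Ffsurj z; rewrite [RHS]fmap0 // -(@fmap_comp _ _ T q f); apply: fmap0 => {}x.
by apply/quotient_map_eq0/range_submodP; exists x.
Qed.

Lemma fmap_kernel (I : Type) N L (W : I -> _) (k : {linear m N -> m L})
    (s : forall i, {linear m L -> m (W i)}) :
  injective k -> (forall x, (forall i, s i x = 0) -> exists y, x = k y) ->
  forall z, (forall i, fmap (s i) z = 0) -> exists y, z = fmap k y.
Proof.
move=> kinj ker_s z sz0; have [T [h [t [zE hP]]]] := element_map z; rewrite -zE.
have [|g gE] := corestrict (h := h) kinj.
  by move=> x; apply: ker_s => i; apply: hP.
by exists (fmap g t); rewrite -fmap_comp; apply: fmap_ext => x; rewrite /= gE.
Qed.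

(** F X is a summand of any projective module that covers it. *)
Lemma fmap_projective X : projective (m X) -> projective (m' X).
Proof.
move=> Xproj; have [P' [p' [P'proj p'surj CP'P]]] := class_cover CP' (@img_modP X).
have [T [u [v [uv vu]]]] := ess_surj CP'P.
have [p pE] := fmap_full (p' \o u : {linear m' T -> m' X}).
have [|s sE] := @projective_split _ _ _ p Xproj.
  apply: surj_fmap => x; have [y <-] := p'surj x.
  by exists (v y); rewrite pE /= vu.
apply: (@projective_retract _ _ _ (u \o fmap s) p') P'proj => x.
rewrite -[LHS]pE -fmap_comp -[RHS]fmap_id; exact: fmap_ext.
Qed.

(** A chain of submodules of F X is transported through the quotients of F X,
    which belong to the class even where the submodules are not known to. *)
Lemma fmap_noetherian X : noetherian_mod (m X) -> noetherian_mod (m' X).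
Proof.
move=> Xnoeth S Sinc; pose q' n := quotient_map (S n).
have hT n : exists T : {T : @full_subcategory (Mod A) C &
    ({linear m' T -> quotmod (S n)} * {linear quotmod (S n) -> m' T} * {linear m X -> m T})%type},
    [/\ cancel (projT2 T).1.1 (projT2 T).1.2, cancel (projT2 T).1.2 (projT2 T).1.1 &
       forall x, fmap (projT2 T).2 x = (projT2 T).1.2 (q' n x)].
  have [T [u [v [uv vu]]]] :=
    ess_surj (class_surj CP' (@quotient_map_surj _ _ (S n)) (@img_modP X)).
  have [q qE] := fmap_full (v \o q' n : {linear m' X -> m' T}).
  by exists (existT _ T (u, v, q)).
pose T n := projT1 (cid (hT n)).
pose To n := projT1 (T n).
pose u n : {linear m' (To n) -> quotmod (S n)} := (projT2 (T n)).1.1.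
pose v n : {linear quotmod (S n) -> m' (To n)} := (projT2 (T n)).1.2.
pose q n : {linear m X -> m (To n)} := (projT2 (T n)).2.
have uvq n : [/\ cancel (u n) (v n), cancel (v n) (u n) &
    forall x, fmap (q n) x = v n (q' n x)] by exact: projT2 (cid (hT n)).
have qsurj n : surjective (q n).
  apply: surj_fmap => y; have [uvn _ qE] := uvq n.
  by have [x xE] := quotient_map_surj (u n y); exists x; rewrite qE xE uvn.
have memS n x : (x \in S n) <-> fmap (q n) x = 0.
  have [_ vun ->] := uvq n; rewrite -quotient_map_eq0; split=> [->|]; first exact: linear0.
  by move=> /(congr1 (u n)); rewrite vun linear0.
have le_ker n n' : (forall x, q n x = 0 -> q n' x = 0) -> {subset S n <= S n'}.
  move=> qq x /memS x0; apply/memS.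
  have [d dE] := factor_surj (qsurj n) qq.
  have /fmap_ext -> : q n' =1 d \o q n by move=> y; rewrite /= dE.
  by rewrite fmap_comp x0 linear0.
have ker_le n n' : {subset S n <= S n'} -> forall x, q n x = 0 -> q n' x = 0.
  move=> SS; have [d dE] : exists d : {linear m' (To n) -> m' (To n')},
      forall x, d (fmap (q n) x) = fmap (q n') x.
    apply: factor_surj; last by move=> x /memS /SS /memS.
    exact: fmap_surj.
  have [c cE] := fmap_full d.
  suff cq x : c (q n x) = q n' x by move=> x x0; rewrite -cq x0 linear0.
  by move: x; apply: (@fmap_faithful _ _ (c \o q n) (q n')) => x; rewrite fmap_comp cE dE.
have [n0 n0P] : exists n, forall k, (n <= k)%N -> kernel (q k) =i kernel (q n).
  apply: Xnoeth => n x /kernelP x0; apply/kernelP; exact: ker_le (Sinc n) _ x0.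
exists n0 => k n0k x; apply/idP/idP; last exact: chain_le.
by apply: le_ker => y /kernelP; rewrite n0P // => /kernelP.
Qed.

Lemma fmap_simple_quotient X Y (p : {linear m X -> m Y}) :
  simple_quotient p -> simple_quotient (fmap p).
Proof.
move=> [psurj [x px] psimple]; split; first exact: fmap_surj.
  apply: contrapT => no; apply: px; move: x.
  apply: (@fmap_faithful _ _ p \0) => z; rewrite [RHS]fmap0 //.
  by apply: contrapT => pz; apply: no; exists z.
move=> N' h' h'surj.
have [T [u [v [uv vu]]]] := ess_surj (class_surj CP' h'surj (@img_modP Y)).
have [h hE] := fmap_full (v \o h' : {linear m' Y -> m' T}).
case: (psimple _ h) => [|h0|hinj].
- by apply: surj_fmap => y; have [z zE] := h'surj (u y); exists z; rewrite hE /= zE uv.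
- by left=> y; rewrite -[LHS]vu -[v _]hE fmap0 // linear0.
- by right=> y y' hyy'; apply: (fmap_inj hinj); rewrite !hE /= hyy'.
Qed.

(** A nonzero element of F X comes from a nonzero element of X, which survives in
    a simple quotient. *)
Lemma fmap_radical_free X : radical_free (m X) -> radical_free (m' X).
Proof.
move=> /radical_freeP Xsep; apply/radical_freeP => z z0.
have [T [h [t [htz hP]]]] := element_map z.
have [s hs0] : exists s, h s <> 0.
  apply: contrapT => no; apply: z0; rewrite -htz; apply: fmap0 => s.
  by apply: contrapT => hs; apply: no; exists s.
have [Q [p [psimple phs]]] := Xsep _ hs0; have [psurj _ _] := psimple.
pose Y := mk_obj (class_surj CP psurj (@obj_modP X)).
exists (m' Y), (@fmap X Y p); split; first exact: (@fmap_simple_quotient X Y).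
by move=> /(hP Y) ph0; apply: phs; apply: ph0.
Qed.

Section LeftNoetherian.
Hypothesis A_noeth : noetherian_mod (A^o).

(** F preserves biproducts, hence the addition of maps, which is defined in
    terms of them. *)
Lemma fmapD X Y (f g : {linear m X -> m Y}) x : fmap (f \+ g) x = fmap f x + fmap g x.
Proof.
pose YY := mk_obj (class_prod CP A_noeth (@obj_modP Y) (@obj_modP Y)).
pose p1 : {linear m YY -> m Y} := fst; pose p2 : {linear m YY -> m Y} := snd.
have i1L : linear (fun y : m Y => (y, 0) : m YY).
  by move=> a u v; apply: injective_projections; rewrite //= scaler0 addr0.
have i2L : linear (fun y : m Y => (0, y) : m YY).
  by move=> a u v; apply: injective_projections; rewrite //= scaler0 addr0.
pose i1 : {linear m Y -> m YY} := mk_linear i1L.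
pose i2 : {linear m Y -> m YY} := mk_linear i2L.
have dL : linear (fun x : m X => (f x, g x) : m YY).
  by move=> a u v; apply: injective_projections; exact: linearP.
pose d : {linear m X -> m YY} := mk_linear dL.
have p_inj z : fmap p1 z = 0 -> fmap p2 z = 0 -> z = 0.
  move=> p1z p2z; have [T [h [t [zE hP]]]] := element_map z; rewrite -zE.
  apply: fmap0 => y; apply: injective_projections; first exact: (hP _ p1).
  exact: (hP _ p2).
have fmap1 (h : {linear m Y -> m Y}) y : (forall w, h w = w) -> fmap h y = y.
  by move=> hw; rewrite -[RHS]fmap_id; apply: fmap_ext.
have dE : fmap d x = fmap i1 (fmap f x) + fmap i2 (fmap g x).
  apply/eqP; rewrite -subr_eq0; apply/eqP; apply: p_inj; rewrite linearB linearD -!fmap_comp.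
    rewrite [X in _ - (_ + X)]fmap0 // addr0.
    by apply/eqP; rewrite subr_eq0; apply/eqP/fmap_ext.
  rewrite [X in _ - (X + _)]fmap0 // add0r.
  by apply/eqP; rewrite subr_eq0; apply/eqP/fmap_ext.
have -> : fmap (f \+ g) x = fmap (p1 \+ p2) (fmap d x).
  by rewrite -fmap_comp; apply: fmap_ext.
rewrite dE linearD -!fmap_comp; congr (_ + _); apply: fmap_ext => y /=.
  by rewrite addr0.
by rewrite add0r.
Qed.

Lemma fmap_sum (I : finType) X Y (f : I -> {linear m X -> m Y}) x :
  fmap (sum_map f) x = \sum_i fmap (f i) x.
Proof.
have sumL (s : seq I) : linear (fun x => \sum_(i <- s) f i x).
  move=> k u v; rewrite scaler_sumr -big_split /=.
  by apply: eq_bigr => i _; rewrite linearP.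
have sumE (s : seq I) : fmap (mk_linear (sumL s)) x = \sum_(i <- s) fmap (f i) x.
  elim: s => [|i s IHs]; first by rewrite big_nil fmap0 // => y; exact: big_nil.
  rewrite big_cons -IHs -fmapD; apply: fmap_ext => y; exact: big_cons.
by rewrite -sumE; apply: fmap_ext.
Qed.

Lemma fmap_retract X Y :
  retract_of_power (m X) (m Y) -> retract_of_power (m' X) (m' Y).
Proof.
move=> [I [a [b abE]]]; exists I, (fun i => fmap (a i)), (fun i => fmap (b i)) => z.
rewrite (eq_bigr (fun i => fmap (b i \o a i) z)); last by move=> i _; rewrite fmap_comp.
by rewrite -fmap_sum -[LHS]fmap_id; apply: fmap_ext => x; exact: abE.
Qed.

Lemma fmap_presentation W : exists L N (e : {linear m L -> m W}) (k : {linear m N -> m L}),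
  [/\ projective (m L), surjective e, injective k &
      forall x, e x = 0 <-> exists y, x = k y].
Proof.
have [P [p [Pproj psurj CPP]]] := class_cover CP (@obj_modP W).
pose N := mk_obj (class_inj CP A_noeth (@submod_incl_inj _ _ (kernel p)) CPP).
exists (mk_obj CPP), N, p, (submod_incl (kernel p)); split=> //.
  exact: submod_incl_inj.
by move=> x; rewrite -submod_inclE; split=> [/kernelP|/kernelP].
Qed.

Lemma fmap_is_syzygy L N W (e : {linear m L -> m W}) (k : {linear m N -> m L}) :
  projective (m L) -> surjective e -> injective k ->
  (forall x, e x = 0 <-> exists y, x = k y) -> is_syzygy (m' W) (m' N).
Proof.
move=> Lproj esurj kinj ek; exists (m' L), (fmap e), (fmap k); split.
- exact: fmap_projective.
- exact: fmap_surj.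
- exact: fmap_inj.
move=> z; split=> [ez0|[y ->]]; last first.
  by rewrite -fmap_comp; apply: fmap0 => x /=; apply/ek; exists x.
apply: (@fmap_kernel unit _ _ (fun=> W) k (fun=> e)) => // x x0.
exact/ek/(x0 tt).
Qed.

Lemma fmap_nth_syzygy n X :
  exists W, nth_syzygy n (m X) (m W) /\ nth_syzygy n (m' X) (m' W).
Proof.
elim: n => [|n [W [XW XW']]]; first by exists X.
have [L [N [e [k [Lproj esurj kinj ek]]]]] := fmap_presentation W.
exists N; split; [exists (m W)|exists (m' W)]; split=> //.
  by exists (m L), e, k.
exact: (fmap_is_syzygy Lproj esurj kinj ek).
Qed.

(** All that enters the condition, once partial linear maps are replaced by maps
    defined on kernels, are kernels of families of maps in the category. *)
Lemma fmap_ext1_dies L W Y Z (e : {linear m L -> m W}) :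
  ext1_dies e (m Y) (m Z) -> ext1_dies (fmap e) (m' Y) (m' Z).
Proof.
move=> dies f' f'L.
pose incl (S : submodClosed (m L)) :=
  mk_obj (class_inj CP A_noeth (@submod_incl_inj _ _ S) (@obj_modP L)).
pose N := incl (kernel e); pose k : {linear m N -> m L} := submod_incl (kernel e).
have kinj : injective k by exact: submod_incl_inj.
have ker_e x : e x = 0 -> exists y, x = k y by move=> /kernelP/submod_inclE.
have ek y : e (k y) = 0 by apply/kernelP/submod_inclP.
have Fek z : fmap e (fmap k z) = 0 by rewrite -fmap_comp fmap0.
have fkL : linear (f' \o fmap k).
  by move=> a u v /=; rewrite linearP f'L.
have [f fE] := fmap_full (mk_linear fkL : {linear m' N -> m' Z}).
have [fe feE] : exists fe : m L -> m Z, forall y, fe (k y) = f y.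
  by apply: descend => y /(injective_eq0 kinj) ->; exact: linear0.
have feL : linear_on [set x | e x = 0] fe.
  by move=> a u v /ker_e u0 /ker_e v0; apply: (descend_linear_on feE).
have [I [s [g [gL gfe]]]] := dies fe feL.
pose se i : {linear m L -> m Y} := s i \o e.
pose V := kernel (tuple_map se); pose M := incl V.
pose j : {linear m M -> m L} := submod_incl V.
have jinj : injective j by exact: submod_incl_inj.
have inV x : x \in V <-> forall i, s i (e x) = 0.
  split=> [/kernelP x0 i|x0]; first by rewrite -[LHS](tuple_mapE se) x0 ffunE.
  by apply/kernelP/ffunP => i; rewrite tuple_mapE ffunE; exact: x0.
have ker_s x : (forall i, se i x = 0) -> exists y, x = j y.
  by move=> x0; apply/submod_inclE/inV.
have gjL : linear (g \o j).
  move=> a u v; transitivity (g (a *: j u + j v)); first by congr g; exact: linearP.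
  by apply: gL; exact/inV/submod_inclP.
pose gj : {linear m M -> m Z} := mk_linear gjL.
have [g' g'E] : exists g' : m' L -> m' Z, forall y, g' (fmap j y) = fmap gj y.
  by apply: descend => y /(injective_eq0 (fmap_inj jinj)) ->; exact: linear0.
exists I, (fun i => fmap (s i)), g'; split=> [a u v u0 v0|x ex0].
  by apply: (descend_linear_on g'E); apply: (fmap_kernel jinj ker_s) => i;
    rewrite fmap_comp.
have [z ->] : exists z, x = fmap k z.
  by apply: (@fmap_kernel unit _ _ (fun=> W) k (fun=> e)) => // y /(_ tt)/ker_e.
have [|t tE] := corestrict (h := k) jinj.
  by move=> y; apply/submod_inclE/inV => i; rewrite ek linear0.
have /fmap_ext -> : k =1 j \o t by move=> y; exact: esym (tE y).
rewrite fmap_comp g'E -fmap_comp.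
have /fmap_ext -> : gj \o t =1 f.
  by move=> y; rewrite -[LHS]/(g (j (t y))) tE gfe // feE.
rewrite fE /= -fmap_comp; congr f'; apply: fmap_ext => y.
exact: esym (tE y).
Qed.

End LeftNoetherian.

End Transport.

Section InverseEquivalence.
Variables (A A' : pzRingType) (C : lmodType A -> Prop) (C' : lmodType A' -> Prop).
Hypotheses (CP : module_class C) (CP' : module_class C').
Variable F : functor (@full_subcategory (Mod A) C) (@full_subcategory (Mod A') C').
Hypothesis F_equiv : is_equivalence F.
Implicit Type X : @full_subcategory (Mod A) C.

Lemma equivalence_inverse :
  exists G : functor (@full_subcategory (Mod A') C') (@full_subcategory (Mod A) C),
    is_equivalence G /\
    forall X, exists (u : {linear img_mod G (F X) -> obj_mod X})
      (v : {linear obj_mod X -> img_mod G (F X)}), cancel u v /\ cancel v u.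
Proof.
have [G [GF FG]] := F_equiv; exists G; split; first by exists F.
have [eta [eta_iso _]] := GF => X; have [v [uv vu]] := eta_iso X.
exists (eta X), v; split=> x.
  by move/(congr1 (fun h : {linear img_mod G (F X) -> img_mod G (F X)} => h x)): uv.
by move/(congr1 (fun h : {linear obj_mod X -> obj_mod X} => h x)): vu.
Qed.

Lemma noetherian_fmap X : noetherian_mod (img_mod F X) -> noetherian_mod (obj_mod X).
Proof.
have [G [Geq /(_ X)[u [v [uv vu]]]]] := equivalence_inverse.
move=> /(@fmap_noetherian _ _ _ _ CP' CP G Geq (F X)).
by apply: (noetherian_surj (f := u)) => x; exists (v x).
Qed.

Lemma projective_fmap X : projective (img_mod F X) -> projective (obj_mod X).
Proof.
have [G [Geq /(_ X)[u [v [uv vu]]]]] := equivalence_inverse.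
move=> /(@fmap_projective _ _ _ _ CP' CP G Geq (F X)).
exact: projective_retract vu.
Qed.

Lemma radical_free_fmap X : radical_free (img_mod F X) -> radical_free (obj_mod X).
Proof.
have [G [Geq /(_ X)[u [v [uv vu]]]]] := equivalence_inverse.
move=> /(@fmap_radical_free _ _ _ _ CP' CP G Geq (F X)).
exact: radical_free_inj (can_inj vu).
Qed.

End InverseEquivalence.

Section NoetherianTransport.
Variables (A A' : pzRingType) (C : lmodType A -> Prop) (C' : lmodType A' -> Prop).
Hypotheses (CP : module_class C) (CP' : module_class C').
Variable F : functor (@full_subcategory (Mod A) C) (@full_subcategory (Mod A') C').
Hypothesis F_equiv : is_equivalence F.
Hypothesis A_noeth : noetherian A.
Local Notation m := (@obj_mod A C).
Local Notation m' := (@img_mod A A' C C' F).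

Let R0 := mk_obj (class_fin_gen CP (fin_gen_regular A)).

(** The sum of the images of all maps F A -> A' is A': the projection of A' onto
    its quotient by that sum composes to 0 with every map F A -> A', hence comes
    from a map that composes to 0 with every map from A. *)
Lemma generator_fmap : exists (I : finType) (p : I -> {linear m' R0 -> A'^o})
  (x : I -> m' R0), 1 = \sum_i p i (x i).
Proof.
pose tr : set A'^o := [set y | exists (I : finType) (p : I -> {linear m' R0 -> A'^o})
  (x : I -> m' R0), y = \sum_i p i (x i)].
have tr0 : tr 0.
  by exists 'I_0, (fun=> \0), (fun=> 0); rewrite big_ord0.
have trD y z : tr y -> tr z -> tr (y + z).
  move=> [I [p [x ->]]] [J [q [w ->]]]; exists (I + J)%type.
  exists (fun i => match i with inl i => p i | inr j => q j end).
  exists (fun i => match i with inl i => x i | inr j => w j end).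
  by rewrite big_sumType.
have trZ a y : tr y -> tr (a *: y).
  move=> [I [p [x ->]]]; exists I, p, (fun i => a *: x i).
  by rewrite scaler_sumr; apply: eq_bigr => i _; rewrite linearZ.
pose q := quotient_map (submod_of_set tr0 trD trZ).
have [X0 [u0 [v0 [uv0 vu0]]]] := ess_surj F_equiv (class_fin_gen CP' (fin_gen_regular A')).
have [Y0 [u1 [v1 [uv1 vu1]]]] := ess_surj F_equiv (class_surj CP'
  (@quotient_map_surj _ _ _ : surjective q) (class_fin_gen CP' (fin_gen_regular A'))).
have [h hE] := fmap_full F_equiv (v1 \o q \o u0 : {linear m' X0 -> m' Y0}).
have h0 x : h x = 0.
  pose s : {linear m R0 -> m X0} := smulr_map x.
  suff hs0 : forall a, (h \o s) a = \0 a by rewrite -[RHS](hs0 1) /= scale1r.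
  apply: (fmap_faithful F_equiv) => z.
  rewrite fmap_comp hE [RHS](fmap0 CP F_equiv) //=.
  have -> : q (u0 (fmap F s z)) = 0; last exact: linear0.
  apply/quotient_map_eq0/asboolP; exists 'I_1, (fun=> u0 \o fmap F s), (fun=> z).
  by rewrite big_ord1.
have : q 1 = 0.
  by rewrite -[LHS]vu1 -(vu0 1) -[v1 _]hE (fmap0 CP F_equiv) // linear0.
by move=> /quotient_map_eq0/asboolP.
Qed.

Lemma left_noetherian_fmap : noetherian_mod (A'^o).
Proof.
have [I [p [x px1]]] := generator_fmap.
pose P : {linear {ffun I -> m' R0} -> A'^o} := sum_map (fun i => p i \o proj_map (m' R0) i).
apply: (noetherian_surj (f := P)) => [a|].
  exists [ffun i => (a : A') *: x i]; rewrite sum_mapE -[RHS](mulr1 (a : A')).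
  rewrite -[RHS]/((a : A') *: (1 : A'^o)) px1 scaler_sumr.
  by apply: eq_bigr => i _; rewrite /= ffunE linearZ.
apply: noetherian_ffun; apply: (fmap_noetherian CP CP' F_equiv).
exact: A_noeth.1.
Qed.

(** For F P = A' the ring End(P) is the converse of A', and the right ideals of
    A' are the left ideals of End(P). Such an ideal S is determined by the right
    A-submodule of Hom(P, A) that consists of the psi with h psi in S for all
    h : A -> P, since the identity of P is a sum of maps through A; and
    Hom(P, A) embeds into a finite power of A since P is finitely generated. *)
Lemma right_noetherian_fmap : noetherian_mod ((A'^c)^o).
Proof.
have A'_noeth := left_noetherian_fmap.
have [X0 [u [v [uv vu]]]] := ess_surj F_equiv (class_fin_gen CP' (fin_gen_regular A')).
have X0proj : projective (m X0).
  apply: (projective_fmap CP CP' F_equiv); apply: (projective_retract uv).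
  exact: projective_regular.
have X0fg : fin_gen (m X0).
  apply/noetherian_fin_gen/(noetherian_fmap CP CP' F_equiv).
  by apply: (noetherian_surj (f := v)) => // x; exists (u x).
have [I [a [b abE]]] := projective_fin_gen_retract X0proj X0fg.
(* the identification of End(X0) with the converse of A' *)
pose ev (f : {linear m X0 -> m X0}) : A'^c := u (fmap F f (v 1)).
have ev_ext (f g : {linear m X0 -> m X0}) : f =1 g -> ev f = ev g.
  by move=> fg; rewrite /ev (fmap_ext fg).
have evD (f g : {linear m X0 -> m X0}) : ev (f \+ g) = ev f + ev g.
  by rewrite /ev (fmapD CP CP' F_equiv A_noeth.1) linearD.
have ev_sum (J : finType) (f : J -> {linear m X0 -> m X0}) : ev (sum_map f) = \sum_j ev (f j).
  by rewrite /ev (fmap_sum CP CP' F_equiv A_noeth.1) linear_sum.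
have evM (f g : {linear m X0 -> m X0}) : ev (f \o g) = (ev f : A'^c) * ev g.
  have gE : fmap F g (v 1) = (ev g : A') *: v 1 by rewrite -linear_from_regular uv.
  by rewrite {1}/ev fmap_comp gE !linearZ.
have ev_surj c : exists f, ev f = c.
  have [f fE] := fmap_full F_equiv (v \o smulr_map (c : A'^o) \o u : {linear m' X0 -> m' X0}).
  by exists f; rewrite /ev fE /= !vu; exact: (mul1r (c : A')).
move=> S Sinc.
pose Psi n : set {linear m X0 -> A^o} := [set psi : {linear m X0 -> A^o} |
  forall h : {linear A^o -> m X0}, ev (h \o psi) \in S n].
(* psi is determined by its values on the generators b k 1 of X0 *)
pose vec (psi : {linear m X0 -> A^o}) : {ffun I -> (A^c)^o} := [ffun k => psi (b k 1)].
pose N n : set {ffun I -> (A^c)^o} := [set w | exists2 psi, Psi n psi & w = vec psi].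
have N0 n : N n 0.
  exists \0 => [h|]; last by apply/ffunP => k; rewrite !ffunE.
  have -> : ev (h \o \0) = 0; last exact: rpred0.
  by rewrite /ev (fmap0 CP F_equiv) ?linear0 // => x; exact: linear0.
have ND n w w' : N n w -> N n w' -> N n (w + w').
  move=> [psi psiP ->] [psi' psi'P ->]; exists (psi \+ psi') => [h|].
    have /ev_ext -> : h \o (psi \+ psi') =1 (h \o psi) \+ (h \o psi').
      by move=> x; rewrite /= linearD.
    by rewrite evD; exact: (rpredD (psiP h) (psi'P h)).
  by apply/ffunP => k; rewrite !ffunE.
have NZ n (r : A^c) w : N n w -> N n (r *: w).
  move=> [psi psiP ->]; pose rho : {linear A^o -> A^o} := smulr_map (r : A^o).
  exists (rho \o psi) => [h|].
    have /ev_ext -> : h \o (rho \o psi) =1 (h \o rho) \o psi by [].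
    exact: (psiP (h \o rho)).
  by apply/ffunP => k; rewrite !ffunE.
pose T n := submod_of_set (@N0 n) (@ND n) (@NZ n).
have [n0 n0P] : exists n, forall k, (n <= k)%N -> T k =i T n.
  apply: (noetherian_ffun A_noeth.2) => n w /asboolP[psi psiP ->]; apply/asboolP.
  by exists psi => // h; exact/Sinc/psiP.
have vec_inj psi psi' : vec psi = vec psi' -> psi =1 psi'.
  move=> eq_vec x; rewrite [x]abE !linear_sum; apply: eq_bigr => k _.
  rewrite linear_from_regular !linearZ; congr (_ *: _).
  by have /ffunP/(_ k) := eq_vec; rewrite !ffunE.
exists n0 => n n0n c; apply/idP/idP; last exact: chain_le.
move=> cS; have [e eE] := ev_surj c.
have ae_n k : Psi n (a k \o e).
  move=> h; have /ev_ext -> : h \o (a k \o e) =1 (h \o a k) \o e by [].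
  by rewrite evM eE; apply: (rpredZ (ev (h \o a k) : A'^c)).
have ae_n0 k : Psi n0 (a k \o e).
  have : vec (a k \o e) \in T n by apply/asboolP; exists (a k \o e).
  rewrite n0P // => /asboolP[psi psiP /vec_inj eq_psi] h.
  have /ev_ext -> : h \o (a k \o e) =1 h \o psi by move=> x; exact: congr1 (eq_psi x).
  exact: psiP.
rewrite -eE; have /ev_ext -> : e =1 sum_map (fun k => b k \o (a k \o e)).
  by move=> x; exact: abE.
by rewrite ev_sum; apply: rpred_sum => k _; apply: ae_n0.
Qed.

Lemma noetherian_transport : noetherian A'.
Proof. by split; [exact: left_noetherian_fmap|exact: right_noetherian_fmap]. Qed.

(** Being finitely generated is transported as the ascending chain condition. *)
Lemma fin_gen_fmap X : fin_gen (m' X) -> fin_gen (m X).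
Proof.
move=> /(fin_gen_noetherian left_noetherian_fmap) FXnoeth.
exact/noetherian_fin_gen/(noetherian_fmap CP CP' F_equiv).
Qed.

Lemma fmap_fin_gen X : fin_gen (m X) -> fin_gen (m' X).
Proof.
move=> /(fin_gen_noetherian A_noeth.1) Xnoeth.
exact/noetherian_fin_gen/(fmap_noetherian CP CP' F_equiv).
Qed.

Section Semiperfect.
Hypothesis A_semiperfect : semiperfect A.

(** F maps a projective cover to one: a submodule S of F P that covers M'
    comes from a map i into P whose image covers M, so i is surjective. *)
Lemma semiperfect_transport : semiperfect A'.
Proof.
move=> M' M'fg.
have [X [u [v [uv vu]]]] := ess_surj F_equiv (class_fin_gen CP' M'fg).
have Xfg : fin_gen (m X).
  by apply: fin_gen_fmap; apply: (fin_gen_surj (f := v)) => // x; exists (u x).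
have [P [p pcover]] := A_semiperfect Xfg; have [Pproj psurj psup] := pcover.
have Pfg := projective_cover_fin_gen pcover Xfg.
pose PP := mk_obj (class_fin_gen CP Pfg); pose pp : {linear m PP -> m X} := p.
exists (m' PP), (u \o fmap F pp); split.
- exact: (fmap_projective CP CP' F_equiv).
- move=> y; have [x xE] := fmap_surj CP CP' F_equiv (psurj : surjective pp) (v y).
  by exists x; rewrite /= xE vu.
move=> S Sker.
have [T [u1 [v1 [uv1 vu1]]]] := ess_surj F_equiv
  (class_inj CP' left_noetherian_fmap (@submod_incl_inj _ _ S) (img_modP F PP)).
have [i iE] := fmap_full F_equiv (submod_incl S \o u1 : {linear m' T -> m' PP}).
pose pi : {linear m T -> m X} := pp \o i.
have pisurj : surjective pi.
  apply: (surj_fmap CP F_equiv) => y.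
  have [x xE] := fmap_surj CP CP' F_equiv (psurj : surjective pp) y.
  have [k [s [/= k0 sS xks]]] := Sker x; have [s' sE] := (submod_inclE _ _).1 sS.
  exists (v1 s'); rewrite fmap_comp iE.
  rewrite -[LHS]/(fmap F pp (submod_incl S (u1 (v1 s')))) vu1 -sE -xE xks linearD.
  by rewrite (can_inj uv (etrans k0 (esym (linear0 u)))) add0r.
have isurj : surjective i.
  suff iall x : x \in range_submod i.
    by move=> x; have /range_submodP[t ->] := iall x; exists t.
  apply: psup => {}x; have [t tE] := pisurj (p x); exists (x - i t), (i t); split.
  - by rewrite /= linearB -tE; exact: subrr.
  - by apply/range_submodP; exists t.
  - by rewrite subrK.
move=> x; have [t <-] := fmap_surj CP CP' F_equiv isurj x.
by rewrite iE; exact: submod_inclP.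
Qed.

End Semiperfect.

End NoetherianTransport.

(** * Quasi-Koszul algebras and modules *)

Lemma ext_prod_topP (K : fieldType) (B : algType K) (M : lmodType B) n :
  semiperfect B ->
  @ext_prod _ _ n 1 M (top B) (top B) setT setT = setT <->
  ext1_dies (free_aug (iter n (@syzygy K B) M)) (top B) (top B).
Proof.
move=> Bsemi; split; first exact: ext_prod_ext1_dies.
by apply: ext1_dies_ext_prod => I N j; exact: (top_power_retraction Bsemi).
Qed.

Lemma lin_span_sub (K : fieldType) (V : lmodType K) (S T : set V) :
  S `<=` T -> lin_span S `<=` lin_span T.
Proof.
by move=> ST v [n [a [x [xS ->]]]]; exists n, a, x; split=> // i; apply/ST/xS.
Qed.

Lemma yoneda_generated01P (K : fieldType) (B : algType K) (T : lmodType B) :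
  yoneda_generated01 T <-> forall n, @ext_prod _ _ n.+1 1 T T T setT setT = setT.
Proof.
split=> [gen n|prodT n].
  rewrite -subTset -(gen n); apply: lin_span_sub => z [xi [zeta [_ _ ->]]].
  by exists xi, zeta.
elim: n => [|n IHn]; first exact: (prodT 0).
rewrite -[LHS]/(@ext_prod _ _ n.+2 1 T T T (@ext1_pow _ _ T n.+1) setT) IHn.
exact: prodT.
Qed.

Lemma nth_syzygy_free (K : fieldType) (B : algType K) (M : lmodType B) n :
  nth_syzygy n M (iter n (@syzygy K B) M).
Proof.
elim: n => // n IHn; exists (iter n (@syzygy K B) M); split=> //.
exists (free_mod B (iter n (@syzygy K B) M)), (free_aug _).
exists (submod_incl (ker (free_aug _))); split.
- exact: free_projective.
- exact: free_aug_surj.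
- exact: submod_incl_inj.
by move=> x; rewrite -submod_inclE; split=> [x0|/asboolP//]; apply/asboolP.
Qed.

Section QuasiKoszul.
Variables (K : fieldType) (A A' : algType K).
Variables (C : lmodType A -> Prop) (C' : lmodType A' -> Prop).
Hypotheses (CP : module_class C) (CP' : module_class C').
Variable F : functor (@full_subcategory (Mod A) C) (@full_subcategory (Mod A') C').
Hypothesis F_equiv : is_equivalence F.
Hypotheses (A_noeth : noetherian A) (A_semiperfect : semiperfect A).
Local Notation m := (@obj_mod A C).
Local Notation m' := (@img_mod A A' C C' F).

Let A'_noeth : noetherian A'.
Proof. exact: (noetherian_transport CP CP' F_equiv). Qed.

Let A'_semiperfect : semiperfect A'.
Proof. exact: (semiperfect_transport CP CP' F_equiv). Qed.

Let T0 := mk_obj (class_fin_gen CP (fin_gen_top A)).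

Lemma top_retract_fmap X : fin_gen (m' X) -> radical_free (m' X) ->
  retract_of_power (m X) (top A).
Proof.
move=> FXfg FX0; apply: radical_free_retract => //.
  exact: (fin_gen_fmap CP CP' F_equiv).
exact: (radical_free_fmap CP CP' F_equiv).
Qed.

Lemma retract_top'_fmap : retract_of_power (top A') (m' T0).
Proof.
have [X [u [v [uv vu]]]] := ess_surj F_equiv (class_fin_gen CP' (fin_gen_top A')).
apply: (retract_iso vu); apply: (fmap_retract CP CP' F_equiv A_noeth.1).
apply: top_retract_fmap.
  by apply: (fin_gen_surj (f := v)) (fin_gen_top A') => x; exists (u x).
exact: radical_free_inj (can_inj uv) (@radical_free_top _).
Qed.

Lemma fmap_retract_top' : retract_of_power (m' T0) (top A').
Proof.
apply: radical_free_retract => //.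
  exact/(fmap_fin_gen CP CP' F_equiv A_noeth)/fin_gen_top.
exact/(fmap_radical_free CP CP' F_equiv)/radical_free_top.
Qed.

(** The criterion goes from M to a presentation, inside the class, of a syzygy of
    X, from there through F, and from the syzygies of F X to those of M'. *)
Lemma ext_prod_transport X (M : lmodType A) (M' : lmodType A') n :
  stable_retract (m X) M -> stable_retract M' (m' X) ->
  @ext_prod _ _ n 1 M (top A) (top A) setT setT = setT ->
  @ext_prod _ _ n 1 M' (top A') (top A') setT setT = setT.
Proof.
move=> XM M'X /(ext_prod_topP _ _ A_semiperfect) diesM.
apply/(ext_prod_topP _ _ A'_semiperfect).
have [W [XW XW']] := fmap_nth_syzygy CP CP' F_equiv A_noeth.1 n X.
have [L [N [e [k [Lproj esurj _ _]]]]] := fmap_presentation CP A_noeth.1 W.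
have WM := stable_retract_nth_syzygy XM XW (nth_syzygy_free M n).
have M'W := stable_retract_nth_syzygy M'X (nth_syzygy_free M' n) XW'.
have die : ext1_dies e (m T0) (m T0).
  apply: ext1_dies_stable_retract Lproj esurj _ _ WM diesM.
    exact: free_projective.
  exact: free_aug_surj.
have die' := fmap_ext1_dies CP CP' F_equiv A_noeth.1 die.
apply: (ext1_dies_stable_retract _ _ _ _ M'W).
- exact: free_projective.
- exact: free_aug_surj.
- exact: (fmap_projective CP CP' F_equiv Lproj).
- exact: (fmap_surj CP CP' F_equiv esurj).
apply: (retract_ext1_dies_coef retract_top'_fmap).
exact: (retract_ext1_dies_test fmap_retract_top').
Qed.

Lemma quasi_koszul_mod_transport X :
  quasi_koszul_mod (m X) -> quasi_koszul_mod (m' X).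
Proof.
move=> [_ _ prodT]; split=> // n.
by apply: (@ext_prod_transport X (m X)) => //; exact: stable_retract_refl.
Qed.

Lemma quasi_koszul_transport : quasi_koszul A -> quasi_koszul A'.
Proof.
move=> [_ _ /yoneda_generated01P prodT]; split=> //; apply/yoneda_generated01P => n.
have [X [u [v [uv vu]]]] := ess_surj F_equiv (class_fin_gen CP' (fin_gen_top A')).
apply: (@ext_prod_transport X (top A)) => //; last exact: stable_retract_iso vu.
apply/retract_stable_retract/top_retract_fmap.
  by apply: (fin_gen_surj (f := v)) (fin_gen_top A') => x; exists (u x).
exact: radical_free_inj (can_inj uv) (@radical_free_top _).
Qed.

End QuasiKoszul.

Section AllModules.
Variables (R S : pzRingType) (F : functor (Mod R) (Mod S)).

(** Mod Q in the form of a full subcategory, so that both kinds of functors are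
    instances of one. *)
Definition allMod (Q : pzRingType) : category :=
  @full_subcategory (Mod Q) (fun _ => True).

Definition functor_allMod : functor (allMod R) (allMod S) :=
  @Functor (allMod R) (allMod S) (fun X => exist _ (F (sval X)) I)
    (fun X Y f => fhom F f) (fun X => fhom1 F (sval X))
    (fun X Y Z g f => fhomM F g f).

End AllModules.

Lemma equivalence_allMod (R S : pzRingType) (F : functor (Mod R) (Mod S)) :
  is_equivalence F -> is_equivalence (functor_allMod F).
Proof.
move=> [G [[eta [eta_iso eta_nat]] [eps [eps_iso eps_nat]]]].
exists (functor_allMod G); split.
  exists (fun X : allMod R => eta (sval X)); split=> [X|X Y f]; first exact: eta_iso.
  exact: eta_nat.
exists (fun X : allMod S => eps (sval X)); split=> [X|X Y f]; first exact: eps_iso.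
exact: eps_nat.
Qed.

Theorem theorem1 (K : fieldType) (A A' : algType K)
    (A_noetherian : noetherian A) (A_semiperfect : semiperfect A) :
  (forall F : functor (Mod A) (Mod A'), is_equivalence F ->
     (quasi_koszul A -> quasi_koszul A') /\
     (forall M : Mod A, quasi_koszul_mod M -> quasi_koszul_mod (F M)))
  /\
  (forall F : functor (fgMod A) (fgMod A'), is_equivalence F ->
     (quasi_koszul A -> quasi_koszul A') /\
     (forall M : fgMod A,
        quasi_koszul_mod (sval M) -> quasi_koszul_mod (sval (F M)))).
Proof.
split=> F F_equiv.
  have E := equivalence_allMod F_equiv.
  have CP := all_modules_class A; have CP' := all_modules_class A'.
  split; first exact: (quasi_koszul_transport CP CP' E).
  move=> M; exact: (quasi_koszul_mod_transport CP CP' E A_noetherian A_semiperfect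
    (X := exist _ M I)).
have CP := fin_gen_class A; have CP' := fin_gen_class A'.
split; first exact: (quasi_koszul_transport CP CP' F_equiv).
by move=> M; exact: (quasi_koszul_mod_transport CP CP' F_equiv A_noetherian A_semiperfect).
Qed.
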